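(* The action of $HH^\bullet(A)$ on $HH_\bullet(A)$ induced by the cap product is determined (together with the unit of $HH^0(A)=\mathbf{k}$ acting as the identity) by the following equations. For $\Omega=x^n$, $y^n$, $z^n$, or $xy^{n_1}z^{m_1}xy^{n_2}z^{m_2}\cdots xy^{n_p}z^{m_p}$ with $p\ge 1$, $n,n_1,\dots,n_p,m_1,\dots,m_p\ge 1$, and for every $f\in HH^{-1}(A)$ (represented by a cocycle $f:V_1\to A$), $$\Big(\sum_{uvw=\Omega} wu\otimes v\Big)\cap f=-\sum_{uvw=\Omega}u\,f(v)\,w+\mathrm{im}(d_1)\quad\text{in } HH_0(A)=A/\mathrm{im}(d_1),$$ where the sums run over all factorizations of the word $\Omega$ as $uvw$ in the free monoid on $x,y,z$ with $v\in\{x,y,z\}$ a single letter and $u,w$ (possibly empty) words.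
   Context: $\mathbf{k}$ is a field of characteristic $0$, $A=\mathbf{k}\langle x,y,z\rangle/(x^2+yx,\,xz,\,zy)$, $A^e=A\otimes A^{\mathrm{op}}$, $HH_n(A)=\mathrm{Tor}_n^{A^e}(A,A)$, $HH^{-n}(A)=\mathrm{Ext}^n_{A^e}(A,A)$ (cohomology in non-positive degrees). $A$ is Koszul; $HH_\bullet(A)$ is the homology of the complex $A\otimes V_\bullet$ and $HH^\bullet(A)$ is the cohomology of $\mathrm{Hom}(V_\bullet,A)$ coming from the two-sided Koszul resolution, where $V_0=\mathbf{k}$, $V_1=\mathbf{k}\{x,y,z\}$, $V_2=\mathbf{k}\{(x+y)x,xz,zy\}$, $V_3=\mathbf{k}\{(x+y)xz,xzy\}$, $V_4=\mathbf{k}\{(x+y)xzy\}$, $V_n=0$ for $n\geq 5$. Here $d_1:A\otimes V_1\to A$, $d_1(a\otimes p)=ap-pa$, and $f:V_1\to A$ is a cocycle iff $(x+y)f(x)+f(x)x+f(y)x=0$, $xf(z)+f(x)z=0$, $zf(y)+f(z)y=0$. The cap product of a Koszul $m$-cochain $f$ and a Koszul $n$-chain $a_0\otimes a_1\cdots a_n\in A\otimes V_n$ is $(a_0\otimes a_1\cdots a_n)\cap f=(-1)^{mn}a_0f(a_1\cdots a_m)\otimes a_{m+1}\cdots a_n\in A\otimes V_{n-m}$. One has $HH_n(A)=0$ for $n\ne 0,1$, and the classes of the elements $\sum_{uvw=\Omega}wu\otimes v$ span $HH_1(A)$. *)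

(* Defs.v *)
From HB Require Import structures.
From mathcomp Require Import all_boot all_algebra.
From mathcomp Require Import generic_quotient ring_quotient boolp.
From mathcomp Require Import finmap monalg.

Set Implicit Arguments.
Unset Strict Implicit.
Unset Printing Implicit Defensive.

Import GRing.Theory.
Local Open Scope ring_scope.
Local Open Scope quotient_scope.

Record subspace (k : fieldType) (V : lmodType k) := Subspace {
  in_subspace :> V -> Prop;
  subspace0 : in_subspace 0;
  subspaceP : forall (a : k) u v,
    in_subspace u -> in_subspace v -> in_subspace (a *: u + v) }.

Section SubspaceTheory.
Variables (k : fieldType) (V : lmodType k) (S : subspace V).

Definition mem_subspace : {pred V} := fun v => `[< S v >].

Lemma mem_subspaceP v : reflect (S v) (v \in mem_subspace).
Proof. exact: asboolP. Qed.

Lemma mem_subspace_closed : GRing.submod_closed mem_subspace.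
Proof.
split=> [|a u v /mem_subspaceP Su /mem_subspaceP Sv]; apply/mem_subspaceP.
  exact: subspace0.
exact: subspaceP.
Qed.

HB.instance Definition _ :=
  GRing.isSubmodClosed.Build k V mem_subspace mem_subspace_closed.

Record subspace_type := SubspaceElt {
  subspace_val :> V; _ : subspace_val \in mem_subspace }.

HB.instance Definition _ := [isSub for subspace_val].
HB.instance Definition _ := [Choice of subspace_type by <:].
HB.instance Definition _ :=
  GRing.SubChoice_isSubLmodule.Build k V mem_subspace subspace_type
    mem_subspace_closed.

Definition mk_elt (v : V) (Sv : S v) : subspace_type :=
  SubspaceElt (introT (mem_subspaceP v) Sv).

Lemma subspace_valP (u : subspace_type) : S (subspace_val u).
Proof. by case: u => v Sv; apply/mem_subspaceP. Qed.

Definition quotient_space := (Quotient.quot mem_subspace).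

HB.instance Definition _ := GRing.Zmodule.on quotient_space.

Definition proj (v : V) : quotient_space := \pi_(Quotient.quot mem_subspace) v.

Lemma proj_surj (q : quotient_space) : exists v, q = proj v.
Proof. by exists (repr q); rewrite /proj reprK. Qed.

Lemma proj_eqP u v : proj u = proj v <-> S (u - v).
Proof.
split=> [/eqP|Suv].
  by rewrite -Quotient.idealrBE => /mem_subspaceP.
by apply/eqP; rewrite -Quotient.idealrBE; apply/mem_subspaceP.
Qed.

Lemma projD u v : proj (u + v) = proj u + proj v.
Proof. by rewrite /proj !piE. Qed.

Lemma proj_0 : proj 0 = 0.
Proof. by rewrite /proj !piE. Qed.

Definition proj_repr (q : quotient_space) : V := repr q.

Lemma proj_reprK q : proj (proj_repr q) = q.
Proof. by rewrite /proj /proj_repr reprK. Qed.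

Definition quotient_scale (a : k) (q : quotient_space) : quotient_space :=
  proj (a *: proj_repr q).

Lemma quotient_scaleE a v : quotient_scale a (proj v) = proj (a *: v).
Proof.
apply/proj_eqP; rewrite -scalerBr -[_ *: _]addr0.
apply: subspaceP; last exact: subspace0.
by apply/proj_eqP; rewrite proj_reprK.
Qed.

Fact quotient_scaleA a b q :
  quotient_scale a (quotient_scale b q) = quotient_scale (a * b) q.
Proof.
by case: (proj_surj q) => v ->; rewrite !quotient_scaleE scalerA.
Qed.

Fact quotient_scale1 : left_id 1 quotient_scale.
Proof. by move=> q; case: (proj_surj q) => v ->; rewrite quotient_scaleE scale1r. Qed.

Fact quotient_scaleDr : right_distributive quotient_scale +%R.
Proof.
move=> a q r; case: (proj_surj q) => v ->; case: (proj_surj r) => w ->.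
by rewrite -projD !quotient_scaleE -projD scalerDr.
Qed.

Fact quotient_scaleDl q : {morph quotient_scale^~ q : a b / a + b}.
Proof.
move=> a b; case: (proj_surj q) => v ->.
by rewrite !quotient_scaleE -projD scalerDl.
Qed.

HB.instance Definition _ := GRing.Zmodule_isLmodule.Build k quotient_space
  quotient_scaleA quotient_scale1 quotient_scaleDr quotient_scaleDl.

Lemma projZ a v : proj (a *: v) = a *: proj v.
Proof. exact/esym/quotient_scaleE. Qed.

Fact proj_is_linear : linear proj.
Proof. by move=> a u v; rewrite projD projZ. Qed.

HB.instance Definition _ := GRing.isLinear.Build k V quotient_space *:%R proj
  proj_is_linear.

End SubspaceTheory.

Section SubspaceOps.
Variables (k : fieldType) (V W : lmodType k).

Definition sub_full : subspace V :=
  @Subspace k V (fun _ => True) I (fun _ _ _ _ _ => I).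

Fact sub_meet_0 (S T : subspace V) : S 0 /\ T 0.
Proof. by split; apply: subspace0. Qed.

Fact sub_meet_P (S T : subspace V) (a : k) u v :
  S u /\ T u -> S v /\ T v -> S (a *: u + v) /\ T (a *: u + v).
Proof. by move=> [Su Tu] [Sv Tv]; split; apply: subspaceP. Qed.

Definition sub_meet (S T : subspace V) : subspace V :=
  Subspace (sub_meet_0 S T) (@sub_meet_P S T).

Fact sub_join_0 (S T : subspace V) : exists u v, [/\ S u, T v & 0 = u + v].
Proof. by exists 0, 0; split; rewrite ?addr0 //; apply: subspace0. Qed.

Fact sub_join_P (S T : subspace V) (a : k) (x y : V) :
  (exists u v, [/\ S u, T v & x = u + v]) ->
  (exists u v, [/\ S u, T v & y = u + v]) ->
  exists u v, [/\ S u, T v & a *: x + y = u + v].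
Proof.
move=> [u [v [Su Tv ->]]] [u' [v' [Su' Tv' ->]]].
exists (a *: u + u'), (a *: v + v'); split; try exact: subspaceP.
by rewrite scalerDr addrACA.
Qed.

Definition sub_join (S T : subspace V) : subspace V :=
  Subspace (sub_join_0 S T) (@sub_join_P S T).

Variable f : {linear V -> W}.

Fact sub_preim_0 (T : subspace W) : T (f 0).
Proof. by rewrite linear0; apply: subspace0. Qed.

Fact sub_preim_P (T : subspace W) (a : k) u v :
  T (f u) -> T (f v) -> T (f (a *: u + v)).
Proof. by move=> Tu Tv; rewrite linearP; apply: subspaceP. Qed.

Definition sub_preim (T : subspace W) : subspace V :=
  @Subspace k V (fun v => T (f v)) (sub_preim_0 T) (@sub_preim_P T).

Fact sub_image_0 (S : subspace V) : exists2 v, S v & 0 = f v.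
Proof. by exists 0; [apply: subspace0|rewrite linear0]. Qed.

Fact sub_image_P (S : subspace V) (a : k) (x y : W) :
  (exists2 v, S v & x = f v) -> (exists2 v, S v & y = f v) ->
  exists2 v, S v & a *: x + y = f v.
Proof.
move=> [u Su ->] [v Sv ->]; exists (a *: u + v); first exact: subspaceP.
by rewrite linearP.
Qed.

Definition sub_image (S : subspace V) : subspace W :=
  Subspace (sub_image_0 S) (@sub_image_P S).

Fact sub_kernel_0 : f 0 = 0. Proof. exact: linear0. Qed.

Fact sub_kernel_P (a : k) u v : f u = 0 -> f v = 0 -> f (a *: u + v) = 0.
Proof. by move=> fu fv; rewrite linearP fu fv scaler0 addr0. Qed.

Definition sub_kernel : subspace V :=
  @Subspace k V (fun v => f v = 0) sub_kernel_0 sub_kernel_P.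

End SubspaceOps.

(* Z / (Z \cap B), as a k-module *)
Section Subquotient.
Variables (k : fieldType) (V : lmodType k) (Z B : subspace V).

Definition subquotient : lmodType k :=
  quotient_space (sub_preim (val : {linear subspace_type Z -> V}) B).

Definition cls (z : subspace_type Z) : subquotient := proj _ z.

Lemma cls_eqP u v : cls u = cls v <-> B (val u - val v).
Proof. by rewrite /cls proj_eqP -(raddfB (val : {linear subspace_type Z -> V})). Qed.

End Subquotient.

Notation letter := 'I_3.
Definition lx : letter := @Ordinal 3 0 isT.
Definition ly : letter := @Ordinal 3 1 isT.
Definition lz : letter := @Ordinal 3 2 isT.

Notation free_alg k := {malg k[{fmonom letter}]}.

Section Algebra.
Variable k : fieldType.
Implicit Types (p q g : free_alg k) (w s t : seq letter).

Definition fgen (i : letter) : free_alg k := << fmu i >>.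

Definition is_relator (r : free_alg k) : Prop :=
  [\/ r = fgen lx * fgen lx + fgen ly * fgen lx,
      r = fgen lx * fgen lz | r = fgen lz * fgen ly].

Inductive in_ideal : free_alg k -> Prop :=
| in_ideal0 : in_ideal 0
| in_idealD a r b p : is_relator r -> in_ideal p -> in_ideal (a * r * b + p).

Fact free_scaleAr (c : k) p q : c *: (p * q) = p * (c *: q).
Proof.
apply/malgP=> w; apply: (etrans (mcoeffZ c (p * q) w)).
apply: etrans (esym (mcoeffMlw w (fsubset_refl _) (msuppZ_le c q))).
apply: (etrans (congr1 _ (mcoeffMlw w (fsubset_refl _) (fsubset_refl _)))).
rewrite mulr_sumr.
apply: eq_bigr => u _; rewrite mulr_sumr; apply: eq_bigr => v _.
by rewrite mcoeffZ mulrnAr mulrCA.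
Qed.

Lemma mcoeff_gen (i j : letter) w g :
  (fgen i * g)@_(FMonom (j :: w)) = g@_(FMonom w) *+ (i == j).
Proof.
rewrite (mcoeffMlw _ msuppU_le (fsubset_refl _)) big_seq_fset1 mcoeffUU.
rewrite [in RHS](monalgE g) raddf_sum /= -sumrMnl; apply: eq_bigr => u _.
rewrite mul1r mcoeffU -mulrnA mulnb; congr (_ *+ nat_of_bool _).
rewrite fmP fmM /fmu !fmE /= eqseq_cons andbC.
by rewrite fmP.
Qed.

Lemma mcoeff_gen_nil (i : letter) g : (fgen i * g)@_(FMonom [::]) = 0.
Proof.
rewrite (mcoeffMlw _ msuppU_le (fsubset_refl _)) big_seq_fset1.
by rewrite big1 // => u _; rewrite fmP fmM /fmu !fmE /= mulr0n.
Qed.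

Lemma fmonom_nil : FMonom [::] = mone :> {fmonom letter}.
Proof. by apply/eqP; rewrite fmP fm1. Qed.

Lemma mcoeff_nilM p q :
  (p * q)@_(FMonom [::]) = p@_(FMonom [::]) * q@_(FMonom [::]).
Proof. by rewrite fmonom_nil; exact: rmorphM. Qed.

Lemma mcoeff_nil1 : (1 : free_alg k)@_(FMonom [::]) = 1.
Proof. by rewrite fmonom_nil; exact: rmorph1. Qed.

Fact in_ideal_mcoeff0 p : in_ideal p -> p@_(FMonom [::]) = 0.
Proof.
elim=> [|a r b q rel_r _ IH]; first exact: mcoeff0.
have r0 : r@_(FMonom [::]) = 0.
  case: rel_r => ->; [|exact: mcoeff_gen_nil|exact: mcoeff_gen_nil].
  apply: (etrans (mcoeffD _ _ _)).
  apply: (etrans (congr2 _ (mcoeff_gen_nil _ _) (mcoeff_gen_nil _ _))).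
  exact: addr0.
apply: (etrans (mcoeffD _ _ _)); rewrite IH addr0.
by rewrite (mcoeff_nilM (a * r) b) (mcoeff_nilM a r) r0 mulr0 mul0r.
Qed.

Fact in_ideal_add p q : in_ideal p -> in_ideal q -> in_ideal (p + q).
Proof.
move=> Ip Iq; elim: Ip => [|a r b p' rel_r _ IH]; first by rewrite add0r.
by rewrite -addrA; apply: in_idealD.
Qed.

Fact in_ideal_mull u p : in_ideal p -> in_ideal (u * p).
Proof.
elim=> [|a r b q rel_r _ IH]; first by rewrite mulr0; exact: in_ideal0.
by rewrite mulrDr !mulrA; apply: in_idealD.
Qed.

Fact in_ideal_mulr u p : in_ideal p -> in_ideal (p * u).
Proof.
elim=> [|a r b q rel_r _ IH]; first by rewrite mul0r; exact: in_ideal0.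
by rewrite mulrDl -mulrA; apply: in_idealD.
Qed.

Fact in_ideal_linear (a : k) p q :
  in_ideal p -> in_ideal q -> in_ideal (a *: p + q).
Proof.
move=> Ip Iq; apply: in_ideal_add => //.
by rewrite -[p]mul1r scalerAl; apply: in_ideal_mull.
Qed.

Definition ideal : subspace (free_alg k) := Subspace in_ideal0 in_ideal_linear.

Definition alg := quotient_space ideal.

HB.instance Definition _ := GRing.Lmodule.on alg.

Definition alg_proj (p : free_alg k) : alg := proj ideal p.

Lemma alg_proj_surj (a : alg) : exists p, a = alg_proj p.
Proof. exact: proj_surj. Qed.

Lemma alg_projP p q : alg_proj p = alg_proj q <-> in_ideal (p - q).
Proof. exact: proj_eqP. Qed.

Fact alg_proj_is_linear : linear alg_proj.
Proof. exact: (@proj_is_linear _ _ ideal). Qed.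

HB.instance Definition _ :=
  GRing.isLinear.Build k (free_alg k) alg *:%R alg_proj alg_proj_is_linear.

Definition alg_mul (a b : alg) : alg :=
  alg_proj (@proj_repr _ _ ideal a * @proj_repr _ _ ideal b).

Lemma alg_mulE p q : alg_mul (alg_proj p) (alg_proj q) = alg_proj (p * q).
Proof.
apply/alg_projP.
set p' := proj_repr _; set q' := proj_repr _.
have -> : p' * q' - p * q = (p' - p) * q' + p * (q' - q).
  by rewrite mulrBl mulrBr addrA subrK.
apply: in_ideal_add; [apply: in_ideal_mulr|apply: in_ideal_mull].
  by apply/alg_projP; rewrite /alg_proj proj_reprK.
by apply/alg_projP; rewrite /alg_proj proj_reprK.
Qed.

Fact alg_mulA : associative alg_mul.
Proof.
move=> a b c; case: (alg_proj_surj a) => p ->; case: (alg_proj_surj b) => q ->.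
by case: (alg_proj_surj c) => r ->; rewrite !alg_mulE mulrA.
Qed.

Fact alg_mul1l : left_id (alg_proj 1) alg_mul.
Proof. by move=> a; case: (alg_proj_surj a) => p ->; rewrite alg_mulE mul1r. Qed.

Fact alg_mul1r : right_id (alg_proj 1) alg_mul.
Proof. by move=> a; case: (alg_proj_surj a) => p ->; rewrite alg_mulE mulr1. Qed.

Fact alg_mulDl : left_distributive alg_mul +%R.
Proof.
move=> a b c; case: (alg_proj_surj a) => p ->; case: (alg_proj_surj b) => q ->.
by case: (alg_proj_surj c) => r ->; rewrite -raddfD !alg_mulE -raddfD mulrDl.
Qed.

Fact alg_mulDr : right_distributive alg_mul +%R.
Proof.
move=> a b c; case: (alg_proj_surj a) => p ->; case: (alg_proj_surj b) => q ->.
by case: (alg_proj_surj c) => r ->; rewrite -raddfD !alg_mulE -raddfD mulrDr.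
Qed.

Fact alg_1neq0 : alg_proj 1 != 0.
Proof.
apply/eqP; rewrite -[RHS](raddf0 alg_proj) => /alg_projP.
rewrite subr0 => /in_ideal_mcoeff0; apply/eqP.
by rewrite mcoeff_nil1 oner_eq0.
Qed.

HB.instance Definition _ := GRing.Zmodule_isNzRing.Build alg
  alg_mulA alg_mul1l alg_mul1r alg_mulDl alg_mulDr alg_1neq0.

Fact alg_proj_is_monoid_morphism : monoid_morphism alg_proj.
Proof. split; [reflexivity|move=> p q; exact: esym (alg_mulE p q)]. Qed.

HB.instance Definition _ := GRing.isMonoidMorphism.Build (free_alg k) alg
  alg_proj alg_proj_is_monoid_morphism.

Fact alg_scaleAl (c : k) (a b : alg) : c *: (a * b) = (c *: a) * b.
Proof.
case: (alg_proj_surj a) => p ->; case: (alg_proj_surj b) => q ->.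
by rewrite -rmorphM -!linearZ -rmorphM scalerAl.
Qed.

HB.instance Definition _ := GRing.Lmodule_isLalgebra.Build k alg alg_scaleAl.

Fact alg_scaleAr (c : k) (a b : alg) : c *: (a * b) = a * (c *: b).
Proof.
case: (alg_proj_surj a) => p ->; case: (alg_proj_surj b) => q ->.
by rewrite -rmorphM -!linearZ -rmorphM free_scaleAr.
Qed.

HB.instance Definition _ := GRing.Lalgebra_isAlgebra.Build k alg alg_scaleAr.

Definition agen (i : letter) : alg := alg_proj (fgen i).

End Algebra.

(* The spaces V_n are subspaces of V^{(x)n}, V = k{x,y,z}; here V^{(x)n} is the
   degree n part of k<x,y,z>, and the lists below are bases of the V_n. *)

Section KoszulBasis.
Variable k : fieldType.

Definition koszul_basis_of (R : nzRingType) (x y z : R) (n : nat) : seq R :=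
  match n with
  | 0 => [:: 1]
  | 1 => [:: x; y; z]
  | 2 => [:: (x + y) * x; x * z; z * y]
  | 3 => [:: (x + y) * x * z; x * z * y]
  | 4 => [:: (x + y) * x * z * y]
  | _ => [::]
  end.

Definition koszul_basis (n : nat) : seq (free_alg k) :=
  koszul_basis_of (fgen k lx) (fgen k ly) (fgen k lz) n.

Definition koszul_dim (n : nat) : nat := size (koszul_basis n).

Definition koszul_coef n (j : 'I_(koszul_dim n)) (w : seq letter) : k :=
  ((koszul_basis n)`_j)@_(FMonom w).

Section Split.
Variables (R : lalgType k) (gen : letter -> R) (co : R -> seq letter -> k).
Hypothesis co_D : forall u v w, co (u + v) w = co u w + co v w.
Hypothesis co_Z : forall a u w, co (a *: u) w = a * co u w.
Hypothesis co_1 : co 1 [::] = 1.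
Hypothesis co_gen : forall i j u w, co (gen i * u) (j :: w) = co u w *+ (i == j).
Local Notation basis := (koszul_basis_of (gen lx) (gen ly) (gen lz)).

Let in_V n (u : R) := exists c : 'I_(size (basis n)) -> k,
  u = \sum_j c j *: (basis n)`_j.

Let in_V_basis n (j : nat) : (j < size (basis n))%N -> in_V n (basis n)`_j.
Proof.
move=> lt_j; exists (fun i => (i == Ordinal lt_j)%:R).
rewrite (bigD1 (Ordinal lt_j)) //= eqxx scale1r big1 ?addr0 // => i /negPf ->.
by rewrite scale0r.
Qed.

Let in_VD n u v : in_V n u -> in_V n v -> in_V n (u + v).
Proof.
move=> [c ->] [d ->]; exists (fun j => c j + d j).
by rewrite -big_split; apply: eq_bigr => j _; rewrite scalerDl.
Qed.

Let basis_split n m p (j : nat) : n = (m + p)%N -> (j < size (basis n))%N ->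
  exists u v, [/\ in_V m u, in_V p v & (basis n)`_j = u * v].
Proof.
move=> ->.
have V n' j' := @in_V_basis n' j'.
have VW : in_V 1 (gen lx + gen ly) by apply: in_VD; [exact: (V 1 0)|exact: (V 1 1)].
case: m => [|m] lt_j.
  exists 1, (basis p)`_j; rewrite mul1r.
  by split=> //; [exact: (V 0 0)|exact: V].
case: p lt_j => [|p].
  rewrite addn0 => lt_j; exists (basis m.+1)`_j, 1; rewrite mulr1.
  by split=> //; [exact: V|exact: (V 0 0)].
rewrite addSn addnS.
case: m p => [|[|[|m]]] [|[|[|p]]] //=; rewrite ?addn0 //=;
  case: j => [|[|[|j]]] //= _.
- by exists (gen lx + gen ly), (gen lx); split=> //; exact: (V 1 0).
- by exists (gen lx), (gen lz); split=> //; [exact: (V 1 0)|exact: (V 1 2)].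
- by exists (gen lz), (gen ly); split=> //; [exact: (V 1 2)|exact: (V 1 1)].
- exists (gen lx + gen ly), (gen lx * gen lz); rewrite mulrA.
  by split=> //; exact: (V 2 1).
- exists (gen lx), (gen lz * gen ly); rewrite mulrA.
  by split=> //; [exact: (V 1 0)|exact: (V 2 2)].
- exists (gen lx + gen ly), (gen lx * gen lz * gen ly); rewrite !mulrA.
  by split=> //; exact: (V 3 1).
- exists ((gen lx + gen ly) * gen lx), (gen lz).
  by split=> //; [exact: (V 2 0)|exact: (V 1 2)].
- by exists (gen lx * gen lz), (gen ly); split=> //; [exact: (V 2 1)|exact: (V 1 1)].
- exists ((gen lx + gen ly) * gen lx), (gen lz * gen ly); rewrite !mulrA.
  by split=> //; [exact: (V 2 0)|exact: (V 2 2)].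
- exists ((gen lx + gen ly) * gen lx * gen lz), (gen ly).
  by split=> //; [exact: (V 3 0)|exact: (V 1 1)].
Qed.

Let cat_coef n (u : R) := forall (g : R) (s t : seq letter),
  size s = n -> co (u * g) (s ++ t) = co u s * co g t.

Let co_0 w : co 0 w = 0.
Proof. by rewrite -(scale0r 0) co_Z mul0r. Qed.

Let co_sum (I : finType) (f : I -> R) w : co (\sum_i f i) w = \sum_i co (f i) w.
Proof. by apply: (big_morph (co^~ w)) => [u v|]; rewrite ?co_D ?co_0. Qed.

Let cat_coef1 : cat_coef 0 1.
Proof. by move=> g s t /size0nil ->; rewrite mul1r co_1 mul1r. Qed.

Let cat_coef_gen n i u : cat_coef n u -> cat_coef n.+1 (gen i * u).
Proof.
move=> Hu g [|j s] t //= [sz_s].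
by rewrite -mulrA !co_gen mulrnAl Hu.
Qed.

Let cat_coefD n u v : cat_coef n u -> cat_coef n v -> cat_coef n (u + v).
Proof. by move=> Hu Hv g s t sz; rewrite mulrDl !co_D mulrDl Hu ?Hv. Qed.

Let cat_coefZ n (a : k) u : cat_coef n u -> cat_coef n (a *: u).
Proof. by move=> Hu g s t sz; rewrite -scalerAl !co_Z Hu ?mulrA. Qed.

Let cat_coef0 n : cat_coef n 0.
Proof. by move=> g s t sz; rewrite mul0r !co_0 mul0r. Qed.

Let cat_coef_basis n (j : nat) : cat_coef n (basis n)`_j.
Proof.
have G i : cat_coef 1 (gen i) by rewrite -[gen i]mulr1; apply: cat_coef_gen.
have G2 i u : cat_coef 1 u -> cat_coef 2 (gen i * u) by exact: cat_coef_gen.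
have G3 i u : cat_coef 2 u -> cat_coef 3 (gen i * u) by exact: cat_coef_gen.
have G4 i u : cat_coef 3 u -> cat_coef 4 (gen i * u) by exact: cat_coef_gen.
by case: n => [|[|[|[|[|n]]]]]; case: j => [|[|[|j]]] //=;
  rewrite ?nth_nil // -?mulrA ?mulrDl; try apply: cat_coefD; auto.
Qed.

Let cat_coef_V n u : in_V n u -> cat_coef n u.
Proof.
case=> c ->; elim/big_ind: _ => [|? ? ? ?|j _] //; first exact: cat_coefD.
by apply: cat_coefZ; apply: cat_coef_basis.
Qed.

Lemma basis_coef_split n m p (j : 'I_(size (basis n))) : n = (m + p)%N ->
  exists (cu : 'I_(size (basis m)) -> k) (cv : 'I_(size (basis p)) -> k),
  forall s t, size s = m ->
    co (basis n)`_j (s ++ t) = (\sum_i cu i * co (basis m)`_i s)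
                             * (\sum_i cv i * co (basis p)`_i t).
Proof.
move=> def_n; have [u [v [Vu [cv Vv] ->]]] := basis_split def_n (ltn_ord j).
have Hu := cat_coef_V Vu; case: Vu => cu Vu.
exists cu, cv => s t sz_s; rewrite Hu // Vu Vv !co_sum.
by congr (_ * _); apply: eq_bigr => i _; rewrite co_Z.
Qed.

End Split.

Lemma koszul_coef_split n m p (j : 'I_(koszul_dim n)) : n = (m + p)%N ->
  exists (cu : 'I_(koszul_dim m) -> k) (cv : 'I_(koszul_dim p) -> k),
  forall s t, size s = m ->
    koszul_coef j (s ++ t) = (\sum_i cu i * koszul_coef i s)
                           * (\sum_i cv i * koszul_coef i t).
Proof.
apply: (@basis_coef_split (free_alg k) (fgen k) (fun u w => u@_(FMonom w))).
- by move=> u v w; exact: mcoeffD.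
- by move=> a u w; exact: mcoeffZ.
- exact: mcoeff_nil1.
- by move=> i j' u w; exact: mcoeff_gen.
Qed.

End KoszulBasis.

(* The Koszul complexes A (x) V_n and Hom (V_n, A), where X i is the class of the
   letter i in A.  Functions n.-tuple letter -> A represent both A (x) V^{(x)n},
   with c standing for the sum of the c t (x) t over the words t of length n, and
   Hom (V^{(x)n}, A). *)

Section Koszul.
Variables (k : fieldType) (A : algType k) (X : letter -> A).
Implicit Types (n m p : nat).

Local Notation coef := (@koszul_coef k _).
Local Notation tens n := {ffun n.-tuple letter -> A}.
Local Notation coords n := {ffun 'I_(koszul_dim k n) -> A}.

(* (a_j)_j |-> \sum_j a_j (x) e_j, with (e_j)_j the basis of V_n *)
Definition koszul_tensor n (a : coords n) : tens n :=
  [ffun t => \sum_(j < koszul_dim k n) coef j (tval t) *: a j].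

Fact koszul_tensor_is_linear n : linear (@koszul_tensor n).
Proof.
move=> a u v; apply/ffunP=> t; rewrite !ffunE scaler_sumr -big_split.
apply: eq_bigr => j _; rewrite !ffunE scalerDr; congr (_ + _).
by rewrite !scalerA mulrC.
Qed.

HB.instance Definition _ n := GRing.isLinear.Build k (coords n) (tens n)
  *:%R (@koszul_tensor n) (@koszul_tensor_is_linear n).

(* A (x) V_n, as a subspace of A (x) V^{(x)n} *)
Definition koszul_chains n : subspace (tens n) :=
  sub_image (@koszul_tensor n) (sub_full _).

(* the restriction Hom (V^{(x)n}, A) -> Hom (V_n, A), in the basis of V_n *)
Definition koszul_restr n (F : tens n) : coords n :=
  [ffun j : 'I_(koszul_dim k n) =>
    \sum_(t : n.-tuple letter) coef j (tval t) *: F t].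

Fact koszul_restr_is_linear n : linear (@koszul_restr n).
Proof.
move=> a u v; apply/ffunP=> j; rewrite !ffunE scaler_sumr -big_split.
apply: eq_bigr => t _; rewrite !ffunE scalerDr; congr (_ + _).
by rewrite !scalerA mulrC.
Qed.

HB.instance Definition _ n := GRing.isLinear.Build k (tens n) (coords n)
  *:%R (@koszul_restr n) (@koszul_restr_is_linear n).

(* Hom (V_n, A) is the quotient of Hom (V^{(x)n}, A) by this subspace *)
Definition koszul_null n : subspace (tens n) := sub_kernel (@koszul_restr n).

(* d (a (x) v_1 ... v_{n+1})
     = a v_1 (x) v_2 ... v_{n+1} + (-1)^{n+1} v_{n+1} a (x) v_1 ... v_n *)
Definition koszul_d n (c : tens n.+1) : tens n :=
  [ffun t : n.-tuple letter => \sum_(i : letter)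
    (c [tuple of i :: t] * X i + (-1) ^+ n.+1 * (X i * c [tuple of rcons t i]))].

Fact koszul_d_is_linear n : linear (@koszul_d n).
Proof.
move=> a u v; apply/ffunP=> t; rewrite !ffunE scaler_sumr -big_split.
apply: eq_bigr => i _; rewrite !ffunE !mulrDl !mulrDr /= scalerDr.
by rewrite addrACA -!scalerAl -!scalerAr.
Qed.

HB.instance Definition _ n := GRing.isLinear.Build k (tens n.+1) (tens n)
  *:%R (@koszul_d n) (@koszul_d_is_linear n).

(* (b f) (v_1 ... v_{n+1})
     = f (v_1 ... v_n) v_{n+1} - (-1)^n v_1 f (v_2 ... v_{n+1}) *)
Definition koszul_b n (F : tens n) : tens n.+1 :=
  [ffun u : n.+1.-tuple letter =>
    F [tuple of belast (thead u) (behead_tuple u)] * X (tnth u ord_max)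
    - (-1) ^+ n * (X (thead u) * F [tuple of behead u])].

Fact koszul_b_is_linear n : linear (@koszul_b n).
Proof.
move=> a u v; apply/ffunP=> t; rewrite !ffunE !mulrDl !mulrDr scalerBr.
by rewrite opprD addrACA -!scalerAl -!scalerAr.
Qed.

HB.instance Definition _ n := GRing.isLinear.Build k (tens n) (tens n.+1)
  *:%R (@koszul_b n) (@koszul_b_is_linear n).

Definition cycles n : subspace (tens n) :=
  match n with
  | 0 => koszul_chains 0
  | m.+1 => sub_meet (koszul_chains m.+1) (sub_kernel (@koszul_d m))
  end.

Definition boundaries n : subspace (tens n) :=
  sub_image (@koszul_d n) (koszul_chains n.+1).

(* F is a cocycle (resp. coboundary) when its restriction to V_n is one *)
Definition cocycles n : subspace (tens n) :=
  sub_preim (@koszul_b n) (koszul_null n.+1).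

Definition coboundaries n : subspace (tens n) :=
  match n with
  | 0 => koszul_null 0
  | m.+1 => sub_join (koszul_null m.+1) (sub_image (@koszul_b m) (sub_full _))
  end.

Definition cycle n := subspace_type (cycles n).
Definition cocycle n := subspace_type (cocycles n).

(* Cohomology is indexed by n >= 0: HHc n is HH^{-n}. *)
Definition HH n : lmodType k := subquotient (cycles n) (boundaries n).
Definition HHc n : lmodType k := subquotient (cocycles n) (coboundaries n).

Definition hh_class n (c : cycle n) : HH n := cls _ c.
Definition hhc_class n (F : cocycle n) : HHc n := cls _ F.

(* the coefficient of a word of any length; 0 unless the length is n *)
Definition at_word n (c : tens n) (w : seq letter) : A :=
  if insub w is Some t then c t else 0.

(* (a (x) v_1 ... v_n) \cap f
     = (-1)^{mn} a f (v_1 ... v_m) (x) v_{m+1} ... v_n,  meant for n = m + p *)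
Definition chain_cap n m p (c : tens n) (F : tens m) : tens p :=
  [ffun t : p.-tuple letter =>
    (-1) ^+ (m * n) * \sum_(s : m.-tuple letter) at_word c (s ++ t) * F s].

Lemma at_word_val n (c : tens n) (w : seq letter) (t : n.-tuple letter) :
  w = t -> at_word c w = c t.
Proof. by move=> ->; rewrite /at_word valK. Qed.

Lemma sub_sum (V : lmodType k) (S : subspace V) (I : finType) (f : I -> V) :
  (forall i, S (f i)) -> S (\sum_i f i).
Proof.
move=> Sf; elim/big_ind: _ => [|u v Su Sv|i _ //]; first exact: subspace0.
by rewrite -[u]scale1r; apply: subspaceP.
Qed.

Lemma subZ (V : lmodType k) (S : subspace V) a v : S v -> S (a *: v).
Proof. by move=> Sv; rewrite -[_ *: _]addr0; apply: subspaceP (subspace0 S). Qed.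

Lemma subD (V : lmodType k) (S : subspace V) u v : S u -> S v -> S (u + v).
Proof. by move=> Su Sv; rewrite -[u]scale1r; apply: subspaceP. Qed.

Lemma subN (V : lmodType k) (S : subspace V) v : S v -> S (- v).
Proof. by rewrite -scaleN1r; apply: subZ. Qed.

Lemma scale_sign n (a : A) : (-1) ^+ n * a = ((-1) ^+ n : k) *: a.
Proof.
by rewrite -signr_odd -[in RHS]signr_odd; case: (odd n);
  rewrite ?expr1 ?expr0 ?scaleN1r ?mulN1r ?scale1r ?mul1r.
Qed.

Let at_koszul n (a : coords n) w : size w = n ->
  at_word (koszul_tensor a) w = \sum_(j < koszul_dim k n) coef j w *: a j.
Proof.
move/eqP=> sz_w; rewrite (@at_word_val _ _ w (Tuple sz_w)) //.
by rewrite ffunE.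
Qed.

Let restr_null n (F : tens n) (cu : 'I_(koszul_dim k n) -> k) :
  koszul_null n F ->
  \sum_(t : n.-tuple letter) (\sum_i cu i * coef i (tval t)) *: F t = 0.
Proof.
move=> /ffunP HF; under eq_bigr do rewrite scaler_suml.
rewrite exchange_big big1 //= => j _.
under eq_bigr do rewrite -scalerA.
by rewrite -scaler_sumr; have := HF j; rewrite !ffunE => ->; rewrite scaler0.
Qed.

Let chains_V n (cv : 'I_(koszul_dim k n) -> k) (b : A) :
  koszul_chains n [ffun t => (\sum_i cv i * coef i (tval t)) *: b].
Proof.
exists [ffun j => cv j *: b] => //.
apply/ffunP=> t; rewrite !ffunE scaler_suml; apply: eq_bigr => j _.
by rewrite ffunE scalerA mulrC.
Qed.

Lemma chain_cap_split n m p (a : coords n) (F : tens m) (j : 'I_(koszul_dim k n)) :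
  n = (m + p)%N -> exists cu cv, forall t : p.-tuple letter,
  \sum_(s : m.-tuple letter) (coef j (s ++ t) *: a j) * F s
  = (\sum_i cv i * coef (i : 'I_(koszul_dim k p)) (tval t)) *: (a j *
    \sum_(s : m.-tuple letter)
       (\sum_i cu i * coef (i : 'I_(koszul_dim k m)) (tval s)) *: F s).
Proof.
move=> def_n; have [cu [cv H]] := koszul_coef_split j def_n.
exists cu, cv => t; rewrite mulr_sumr scaler_sumr; apply: eq_bigr => s _.
by rewrite H ?size_tuple // -scalerAl -scalerAr scalerA mulrC.
Qed.

Let chain_capE n m p (a : coords n) (F : tens m) (t : p.-tuple letter) :
  n = (m + p)%N -> chain_cap p (koszul_tensor a) F t
  = (-1) ^+ (m * n) * \sum_j \sum_(s : m.-tuple letter)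
      (coef j (s ++ t) *: a j) * F s.
Proof.
move=> def_n; rewrite ffunE exchange_big; congr (_ * _).
apply: eq_bigr => s _.
by rewrite at_koszul ?size_cat ?size_tuple // mulr_suml.
Qed.

Lemma chain_cap_koszul n m p (c : tens n) (F : tens m) :
  n = (m + p)%N -> koszul_chains n c -> koszul_chains p (chain_cap p c F).
Proof.
move=> def_n [a _ ->].
pose D (j : 'I_(koszul_dim k n)) := [ffun t : p.-tuple letter =>
  \sum_(s : m.-tuple letter) (coef j (s ++ t) *: a j) * F s].
have -> : chain_cap p (koszul_tensor a) F = ((-1) ^+ (m * n) : k) *: \sum_j D j.
  apply/ffunP=> t; rewrite chain_capE // scale_sign !ffunE sum_ffunE.
  by congr (_ *: _); apply: eq_bigr => j _; rewrite ffunE.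
apply/subZ/sub_sum => j.
have [cu [cv H]] := chain_cap_split a F j def_n.
rewrite [D j](_ : _ = [ffun t => (\sum_i cv i * coef i (tval t)) *: (a j *
    \sum_(s : m.-tuple letter) (\sum_i cu i * coef i (tval s)) *: F s)]).
  exact: chains_V.
by apply/ffunP=> t; rewrite !ffunE H.
Qed.

Lemma chain_cap_null n m p (c : tens n) (F : tens m) :
  n = (m + p)%N -> koszul_chains n c -> koszul_null m F -> chain_cap p c F = 0.
Proof.
move=> def_n [a _ ->] F0; apply/ffunP=> t; rewrite chain_capE // ffunE.
rewrite big1 ?mulr0 // => j _.
have [cu [cv ->]] := chain_cap_split a F j def_n.
by rewrite restr_null // mulr0 scaler0.
Qed.

Let at_d n (c : tens n.+1) w : size w = n -> at_word (koszul_d c) w =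
  \sum_(i : letter) (at_word c (i :: w) * X i
                     + (-1) ^+ n.+1 * (X i * at_word c (rcons w i))).
Proof.
move/eqP=> sz_w; rewrite (@at_word_val _ _ w (Tuple sz_w)) // ffunE.
apply: eq_bigr => i _; rewrite (@at_word_val _ _ _ [tuple of i :: Tuple sz_w]) //.
by rewrite (@at_word_val _ _ _ [tuple of rcons (Tuple sz_w) i]).
Qed.

Let sum_cons m (G : m.+1.-tuple letter -> A) :
  \sum_u G u = \sum_(s : m.-tuple letter) \sum_i G [tuple of i :: s].
Proof.
rewrite exchange_big pair_big /=.
rewrite (reindex (fun x : letter * m.-tuple letter => [tuple of x.1 :: x.2])) //.
exists (fun u : m.+1.-tuple letter => (thead u, [tuple of behead u])).
  by move=> [i s] _ /=; congr (_, _); apply: val_inj.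
by move=> u _ /=; rewrite [RHS]tuple_eta; apply: val_inj.
Qed.

Let initt m (u : m.+1.-tuple letter) : m.-tuple letter :=
  [tuple of belast (thead u) (behead_tuple u)].

Let rcons_init m (u : m.+1.-tuple letter) :
  rcons (initt u) (tnth u ord_max) = u.
Proof.
case/tupleP: u => x s; rewrite (tnth_nth x) /= theadE.
by rewrite -{3}(size_tuple s) -last_nth -lastI.
Qed.

Let init_rcons m (s : m.-tuple letter) i :
  initt [tuple of rcons s i] = s /\ tnth [tuple of rcons s i] ord_max = i.
Proof.
have /= := rcons_init [tuple of rcons s i].
by move/rcons_inj => [e1 e2]; split=> //; apply: val_inj.
Qed.

Let sum_rcons m (G : m.+1.-tuple letter -> A) :
  \sum_u G u = \sum_(s : m.-tuple letter) \sum_i G [tuple of rcons s i].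
Proof.
rewrite pair_big /=.
rewrite (reindex (fun x : m.-tuple letter * letter => [tuple of rcons x.1 x.2])) //.
exists (fun u : m.+1.-tuple letter => (initt u, tnth u ord_max)).
  by move=> [s i] _ /=; have [-> ->] := init_rcons s i.
by move=> u _ /=; apply: val_inj; rewrite /= rcons_init.
Qed.

Lemma chain_cap_leibniz n m p (c : tens n.+1) (F : tens m) : n = (m + p)%N ->
  koszul_d (chain_cap p.+1 c F)
  = chain_cap p (koszul_d c) F + (-1) ^+ n.+1 *: chain_cap p c (koszul_b F).
Proof.
move=> def_n; apply/ffunP=> t.
pose T1 := \sum_(s : m.-tuple letter) \sum_i at_word c (s ++ i :: t) * F s * X i.
pose T2 := \sum_(s : m.-tuple letter) \sum_i X i * at_word c (rcons (s ++ t) i) * F s.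
pose T3 := \sum_(s : m.-tuple letter) \sum_i at_word c (i :: s ++ t) * X i * F s.
have -> : koszul_d (chain_cap p.+1 c F) t =
    (-1) ^+ (m * n.+1) * (T1 + (-1) ^+ p.+1 * T2).
  rewrite ffunE big_split /= mulrDr; congr (_ + _).
    rewrite /T1 exchange_big mulr_sumr; apply: eq_bigr => i _.
    by rewrite ffunE -mulrA mulr_suml.
  rewrite /T2 exchange_big !mulr_sumr; apply: eq_bigr => i _.
  rewrite ffunE !scale_sign -!scalerAr !scalerA mulrC; congr (_ *: _).
  rewrite mulr_sumr; apply: eq_bigr => s _.
  by rewrite mulrA /= rcons_cat.
have E2 : chain_cap p (koszul_d c) F t =
    (-1) ^+ (m * n) * (T3 + (-1) ^+ n.+1 * T2).
  rewrite ffunE; congr (_ * _); rewrite /T3 /T2 mulr_sumr -big_split.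
  apply: eq_bigr => s _; rewrite at_d ?size_cat ?size_tuple // mulr_suml.
  rewrite mulr_sumr -big_split; apply: eq_bigr => i _.
  by rewrite mulrDl !mulrA.
have E3 : chain_cap p c (koszul_b F) t =
    (-1) ^+ (m.+1 * n.+1) * (T1 - (-1) ^+ m * T3).
  rewrite ffunE; congr (_ * _).
  under eq_bigr do rewrite ffunE mulrBr.
  rewrite sumrB; congr (_ - _).
    rewrite sum_rcons; apply: eq_bigr => s _; apply: eq_bigr => i _.
    have [e1 e2] := init_rcons s i; rewrite -/(initt _) e1 e2 mulrA.
    by rewrite /= cat_rcons.
  rewrite sum_cons mulr_sumr; apply: eq_bigr => s _; rewrite mulr_sumr.
  apply: eq_bigr => i _; rewrite theadE !scale_sign -scalerAr mulrA.
  by congr (_ *: (_ * F _)); apply: val_inj.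
rewrite [RHS]ffunE E2 [in RHS]ffunE E3 def_n !scale_sign.
have S e : (-1) ^+ e = (-1) ^+ odd e :> k by rewrite signr_odd.
rewrite (S (m * _.+1)%N) (S p.+1) (S (m * _)%N) (S (_ + _).+1) (S (m.+1 * _)%N).
rewrite (S m) !oddM /= !oddD /= => {S E2 E3}.
case: (odd m); case: (odd p); rewrite /= ?expr1 ?expr0 ?scaleN1r ?scale1r.
all: rewrite ?(opprD, opprK, scaleN1r, scaler0, scalerN, scalerDr, scale1r).
all: by rewrite [RHS]addrC addrA ?subrK ?addrK.
Qed.

Lemma chain_cap_is_linearl n m p (F : tens m) :
  linear (fun c : tens n => chain_cap p c F).
Proof.
move=> a c d; apply/ffunP=> t; rewrite !ffunE scalerAr -mulrDr scaler_sumr.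
rewrite -big_split; congr (_ * _); apply: eq_bigr => s _ /=.
rewrite /at_word; case: insub => [u|]; last by rewrite !mul0r scaler0 addr0.
by rewrite !ffunE mulrDl scalerAl.
Qed.

Lemma chain_cap_is_linearr n m p (c : tens n) :
  linear (fun F : tens m => chain_cap p c F).
Proof.
move=> a F G; apply/ffunP=> t; rewrite !ffunE scalerAr -mulrDr scaler_sumr.
rewrite -big_split; congr (_ * _); apply: eq_bigr => s _ /=.
by rewrite !ffunE mulrDr scalerAr.
Qed.

Let chain_capBl n m p (c d : tens n) (F : tens m) :
  chain_cap p (c - d) F = chain_cap p c F - chain_cap p d F.
Proof. by rewrite addrC -[- d]scaleN1r chain_cap_is_linearl scaleN1r addrC. Qed.

Let chain_capBr n m p (c : tens n) (F G : tens m) :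
  chain_cap p c (F - G) = chain_cap p c F - chain_cap p c G.
Proof. by rewrite addrC -[- G]scaleN1r chain_cap_is_linearr scaleN1r addrC. Qed.

Let chain_cap0l n m p (F : tens m) : chain_cap p (0 : tens n) F = 0.
Proof. by rewrite -(subrr 0) chain_capBl subrr. Qed.

Let cycles_chains n (c : tens n) : cycles n c -> koszul_chains n c.
Proof. by case: n c => [|n] c //= []. Qed.

Lemma chain_cap_cycle n m p (c : tens n) (F : tens m) : n = (m + p)%N ->
  cycles n c -> cocycles m F -> cycles p (chain_cap p c F).
Proof.
case: p => [|p] def_n cyc_c coc_F.
  exact: (chain_cap_koszul F def_n (cycles_chains cyc_c)).
split; first exact: (chain_cap_koszul F def_n (cycles_chains cyc_c)).
case: n c def_n cyc_c => [|n] c def_n; first by rewrite addnS in def_n.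
case=> kos_c dc0; rewrite addnS in def_n; case: def_n => def_n.
rewrite /= (chain_cap_leibniz _ _ def_n) (dc0 : koszul_d c = 0) chain_cap0l.
by rewrite chain_cap_null ?scaler0 ?addr0 // def_n addSn.
Qed.

Lemma chain_cap_boundary n m p (c : tens n) (F : tens m) : n = (m + p)%N ->
  boundaries n c -> cocycles m F -> boundaries p (chain_cap p c F).
Proof.
move=> def_n [c' kos_c' ->] coc_F; exists (chain_cap p.+1 c' F).
  by apply: chain_cap_koszul kos_c'; rewrite def_n addnS.
rewrite /= (chain_cap_leibniz _ _ def_n) [chain_cap p c' _]chain_cap_null //.
  by rewrite scaler0 addr0.
by rewrite def_n addSn.
Qed.

Lemma chain_cap_coboundary n m p (c : tens n) (F : tens m) : n = (m + p)%N ->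
  cycles n c -> coboundaries m F -> boundaries p (chain_cap p c F).
Proof.
move=> def_n cyc_c; case: m F def_n => [|m] F def_n /=.
  move=> F0; rewrite (chain_cap_null def_n (cycles_chains cyc_c) F0).
  exact: (subspace0 (boundaries p)).
move=> [F0 [_ [null_F0 [G _ ->] ->]]].
case: n c def_n cyc_c => [|n] c //; rewrite addSn => -[def_n] [kos_c dc0].
have := chain_cap_leibniz c G def_n.
rewrite (dc0 : koszul_d c = 0) chain_cap0l add0r => leib.
have -> : chain_cap p c (F0 + koszul_b G) = chain_cap p c (koszul_b G).
  rewrite -[F0]opprK addrC chain_capBr.
  rewrite [chain_cap p c (- F0)]chain_cap_null ?subr0 //.
    by rewrite addSn def_n.
  exact: (subN (S := koszul_null _)).
have -> : chain_cap p c (koszul_b G)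
        = (-1) ^+ n.+1 *: koszul_d (chain_cap p.+1 c G).
  by rewrite leib scalerA -exprD addnn -signr_odd odd_double scale1r.
apply: (subZ (S := boundaries p)); exists (chain_cap p.+1 c G) => //.
by apply: chain_cap_koszul kos_c; rewrite addnS def_n.
Qed.

Definition cycle_cap m p (c : cycle (m + p)) (F : cocycle m) : cycle p :=
  mk_elt (chain_cap_cycle (erefl (m + p)%N) (subspace_valP c) (subspace_valP F)).

(* the cap product HH_{m+p} (x) HH^{-m} -> HH_p *)
Definition cap m p (xi : HH (m + p)) (phi : HHc m) : HH p :=
  hh_class (cycle_cap (proj_repr xi) (proj_repr phi)).

Lemma capE m p (c : cycle (m + p)) (F : cocycle m) :
  cap (hh_class c) (hhc_class F) = hh_class (cycle_cap c F).
Proof.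
apply/cls_eqP.
set c' := proj_repr _; set F' := proj_repr _.
have Bc : boundaries (m + p) (val c' - val c).
  by apply/cls_eqP; rewrite /cls /c' proj_reprK.
have BF : coboundaries m (val F' - val F).
  by apply/cls_eqP; rewrite /cls /F' proj_reprK.
rewrite [X in boundaries p X](_ : _ =
  chain_cap p (val c' - val c) (val F') + chain_cap p (val c) (val F' - val F)).
  apply: (subD (S := boundaries p)).
    by apply: chain_cap_boundary Bc _ => //; exact: subspace_valP.
  by apply: chain_cap_coboundary _ BF => //; exact: subspace_valP.
by rewrite chain_capBl chain_capBr addrA subrK.
Qed.

Fact const_cycle (a : A) : cycles 0 [ffun=> a].
Proof.
exists [ffun=> a] => //; apply/ffunP=> t; rewrite !ffunE.
apply/esym/(etrans (big_ord1 _ _)); rewrite ffunE (tuple0 t) /koszul_coef /=.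
by rewrite (mcoeff_nil1 k) scale1r.
Qed.

(* the class of a in HH_0 = A / im d_1 *)
Definition hh0_class (a : A) : HH 0 := hh_class (mk_elt (const_cycle a)).

Fact one_cocycle : cocycles 0 [ffun=> 1].
Proof.
rewrite /= [koszul_b _](_ : _ = 0); first exact: (subspace0 (koszul_null 1)).
by apply/ffunP=> u; rewrite !ffunE expr0 !mul1r mulr1 (ord1 ord_max) subrr.
Qed.

Definition hhc_one : HHc 0 := hhc_class (mk_elt one_cocycle).

Definition elem_tensor n (a : A) (t : n.-tuple letter) : tens n :=
  [ffun t' => a *+ (t' == t)].

Definition word (s : seq letter) : A := \prod_(i <- s) X i.

(* The factorizations Omega = u v w with v a letter correspond to the positions
   i < |Omega|, with u = take i Omega and w = drop i.+1 Omega. *)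
Definition rot_chain (Omega : seq letter) : tens 1 :=
  \sum_(i < size Omega)
    elem_tensor (word (drop i.+1 Omega) * word (take i Omega))
                [tuple tnth (in_tuple Omega) i].

Lemma koszul_chains1 (c : tens 1) : koszul_chains 1 c.
Proof.
exists [ffun j : 'I_(koszul_dim k 1) => c [tuple (j : letter)]] => //.
apply/ffunP=> t; rewrite ffunE; case/tupleP: t => i t.
rewrite [t]tuple0 {t} (bigD1 (i : 'I_(koszul_dim k 1))) //= ffunE.
have cE (j i' : letter) :
    koszul_coef (j : 'I_(koszul_dim k 1)) [:: i'] = (j == i')%:R.
  have -> : koszul_coef (j : 'I_(koszul_dim k 1)) [:: i']
          = (fgen k j)@_(FMonom [:: i']).
    rewrite /koszul_coef; congr mcoeff.
    by case: j => [[|[|[|j]]] lt_j]; [| | |by []]; congr (fgen k _); exact: val_inj.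
  rewrite -[fgen k j]mulr1; apply: (etrans (mcoeff_gen _ _ _ _)).
  by rewrite mcoeff_nil1.
rewrite big1 => [|j ne_ji].
  rewrite (cE i i) (eqxx i) scale1r addr0; congr (c _); exact: val_inj.
by rewrite (cE j i) (negPf ne_ji) scale0r.
Qed.

Lemma word_cat s t : word (s ++ t) = word s * word t.
Proof. exact: big_cat. Qed.

Fact rot_chain_cycle Omega : cycles 1 (rot_chain Omega).
Proof.
split; first exact: koszul_chains1.
pose f i := word (drop i Omega) * word (take i Omega).
have dE (a : A) (i : letter) :
    koszul_d (elem_tensor a [tuple i]) = [ffun=> a * X i - X i * a].
  have etE t : elem_tensor a [tuple i] t = a *+ (tval t == [:: i]).
    by rewrite ffunE -val_eqE.
  apply/ffunP=> t; rewrite !ffunE (tuple0 t).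
  under eq_bigr => j _ do rewrite !etE /= eqseq_cons andbT.
  rewrite (bigD1 i) //= big1 => [|j /negPf ne_ji].
    by rewrite (eqxx i) !mulr1n expr1 mulN1r addr0.
  by rewrite ne_ji !mulr0n mul0r !mulr0 addr0.
rewrite /= /rot_chain (raddf_sum (@koszul_d 0)) /=.
under eq_bigr do rewrite dE.
apply/ffunP=> t; rewrite sum_ffunE !ffunE.
transitivity (\sum_(0 <= i < size Omega) (f i.+1 - f i)).
  rewrite big_mkord; apply: eq_bigr => i _; rewrite ffunE /f.
  rewrite (tnth_nth lx) /=; set a := nth _ _ _.
  rewrite (take_nth lx) // [drop i _](drop_nth lx) // -/a -cats1 word_cat.
  by rewrite /word big_seq1 big_cons !mulrA.
rewrite telescope_sumr // /f drop_size take_size drop0 take0.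
by rewrite /word big_nil mul1r mulr1 subrr.
Qed.

Definition rot_cycle (Omega : seq letter) : cycle 1 :=
  mk_elt (rot_chain_cycle Omega).

End Koszul.

Definition is_Omega (Omega : seq letter) : Prop :=
  (exists2 n : nat, (0 < n)%N &
    [\/ Omega = nseq n lx, Omega = nseq n ly | Omega = nseq n lz]) \/
  (exists e : seq (nat * nat),
    [/\ e != [::],
        forall nm, nm \in e -> (0 < nm.1)%N /\ (0 < nm.2)%N
      & Omega = flatten [seq lx :: nseq nm.1 ly ++ nseq nm.2 lz | nm <- e]]).

Section Action.
Variable k : fieldType.
Local Notation X := (@agen k).

(* Graded families of maps HH_n (x) HH^{-m} -> HH_{n-m}; the components with
   n < m are omitted, as their target is a homology group of negative degree. *)
Definition graded_pairing : Type :=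
  forall m p : nat, HH X (m + p) -> HHc X m -> HH X p.

Definition bilinear_pairing (act : graded_pairing) : Prop :=
  forall m p,
    (forall (a : k) (xi eta : HH X (m + p)) (phi : HHc X m),
      act m p (a *: xi + eta) phi = a *: act m p xi phi + act m p eta phi) /\
    (forall (a : k) (xi : HH X (m + p)) (phi psi : HHc X m),
      act m p xi (a *: phi + psi) = a *: act m p xi phi + act m p xi psi).

Definition unit_equation (act : graded_pairing) : Prop :=
  forall (p : nat) (xi : HH X p), act 0 p xi (hhc_one X) = xi.

Definition Omega_equations (act : graded_pairing) : Prop :=
  forall (Omega : seq letter) (f : cocycle X 1), is_Omega Omega ->
    act 1 0 (hh_class (rot_cycle X Omega)) (hhc_class f)
    = - hh0_class X (\sum_(i < size Omega)
          word X (take i Omega)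
          * subspace_val f [tuple tnth (in_tuple Omega) i]
          * word X (drop i.+1 Omega)).

End Action.

(* Main.v *)
Require Import Defs.
From HB Require Import structures.
From mathcomp Require Import all_boot all_algebra.
From mathcomp Require Import finmap monalg zify.
Import GRing.Theory.
Local Open Scope ring_scope.

Set Implicit Arguments.
Unset Strict Implicit.
Unset Printing Implicit Defensive.

(** With [t = x + y] the relators are [tx], [xz] and [zy]. Their ideal [I]
    satisfies [I = R F + V I] in the free algebra [F], which gives the syzygies
    of [x, y, z] in [A] on either side, and from these the exactness of the
    Koszul complex in degrees [n >= 2] and the triviality of the center.

    In degree one the cyclic derivative [rot], which sends a word [s] to the sum
    of [w u (x) v] over [s = u v w], is compared with the map [Psi] that gives
    each term the weight [|u|]: dividing both by [|s|] yields
    [Psi (q v - v q) = q (x) v - rot (q v)] for a letter [v], while for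
    [p] in [I] one has [rot p = d E] with [Psi p] homologous to an explicit image
    of [E].  For a cycle [c] with lift [p = d c~] in [I], [rot p = 0], so [E] is a
    cycle, hence a boundary, and so is [Psi p]; thus [c] is homologous to a
    combination of cyclic derivatives of words.  Modulo boundaries
    these are reduced to the words [Omega] by [yx -> - xx]. *)

(** * Deciding identities in abelian groups by reflection *)

Section ZmodReflection.

Inductive zmod_expr :=
| ZVar of nat | ZZero | ZOpp of zmod_expr | ZAdd of zmod_expr & zmod_expr.

Fixpoint zmod_eval (V : zmodType) (env : seq V) e : V :=
  match e with
  | ZVar i => env`_i
  | ZZero => 0
  | ZOpp e => - zmod_eval env e
  | ZAdd e1 e2 => zmod_eval env e1 + zmod_eval env e2
  end.

Fixpoint zmod_coef e (i : nat) : int :=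
  match e with
  | ZVar j => (i == j)%:R
  | ZZero => 0
  | ZOpp e => - zmod_coef e i
  | ZAdd e1 e2 => zmod_coef e1 i + zmod_coef e2 i
  end.

Fixpoint zmod_closed n e : bool :=
  match e with
  | ZVar j => (j < n)%N
  | ZZero => true
  | ZOpp e => zmod_closed n e
  | ZAdd e1 e2 => zmod_closed n e1 && zmod_closed n e2
  end.

Lemma zmod_evalE (V : zmodType) (env : seq V) e : zmod_closed (size env) e ->
  zmod_eval env e = \sum_(i < size env) env`_i *~ zmod_coef e i.
Proof.
elim: e => [j|_|e IH|e1 IH1 e2 IH2] /=.
- move=> lt_j; rewrite (bigD1 (Ordinal lt_j)) //= eqxx big1 ?addr0 //.
  by move=> i; rewrite -val_eqE /= => /negPf->.
- by rewrite big1.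
- by move=> /IH->; rewrite -sumrN; apply: eq_bigr => i _; rewrite mulrNz.
- move=> /andP[/IH1-> /IH2->]; rewrite -big_split.
  by apply: eq_bigr => i _; rewrite /= mulrzDr.
Qed.

(** The premise is a closed boolean on integer coefficients, so [vm_compute] decides it whatever the
    atoms of [env] are. *)
Lemma zmod_reflect (V : zmodType) (env : seq V) e1 e2 :
  [&& zmod_closed (size env) e1, zmod_closed (size env) e2
    & all (fun i => zmod_coef e1 i == zmod_coef e2 i) (iota 0 (size env))] ->
  zmod_eval env e1 = zmod_eval env e2.
Proof.
move=> /and3P[c1 c2 /allP eq12]; rewrite !zmod_evalE //.
by apply: eq_bigr => i _; rewrite (eqP (eq12 i _)) // mem_iota /=.
Qed.

End ZmodReflection.

(* Atoms are compared up to unification: rewriting leaves products whose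
   structure instances are convertible but not syntactically equal. *)
Ltac zmod_index env v :=
  lazymatch env with
  | ?h :: ?env' =>
      match constr:(tt) with
      | _ => let u := match constr:(tt) with _ => unify h v end in constr:(0%N)
      | _ => let n := zmod_index env' v in constr:(n.+1)
      end
  end.

Ltac zmod_atoms env e :=
  lazymatch e with
  | (?a + ?b)%R => let env' := zmod_atoms env a in zmod_atoms env' b
  | (- ?a)%R => zmod_atoms env a
  | 0%R => env
  | ?a => match env with
          | _ => let n := zmod_index env a in env
          | _ => constr:(a :: env)
          end
  end.

Ltac zmod_reify env e :=
  lazymatch e with
  | (?a + ?b)%R => let a' := zmod_reify env a in let b' := zmod_reify env b in
      constr:(ZAdd a' b')
  | (- ?a)%R => let a' := zmod_reify env a in constr:(ZOpp a')
  | 0%R => constr:(ZZero)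
  | ?a => let n := zmod_index env a in constr:(ZVar n)
  end.

Ltac zmod :=
  lazymatch goal with
  | |- @eq ?V ?a ?b =>
      let env := zmod_atoms (@nil V) a in
      let env := zmod_atoms env b in
      let a' := zmod_reify env a in
      let b' := zmod_reify env b in
      refine (@zmod_reflect _ env a' b' _); vm_compute; reflexivity
  end.

(** Products are expanded without commuting factors; the monomials then become the atoms of
    [zmod]. *)
Ltac ncring :=
  rewrite ?(mulrDl, mulrDr, mulrNN, mulNr, mulrN, mul0r, mulr0, mul1r, mulr1, mulr_algl,
    mulr_algr, scalerDr, mulrA);
  zmod.

(** * Cancellation, cycles and center from the syzygies *)

Section Syzygies.
Variables (k : fieldType) (A : algType k) (x y z : A).
Local Notation t := (x + y).

(** Combinations of words of length less than [n]: an induction measure in place of a degree, since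
    [A] carries no grading here. *)
Inductive filtered : nat -> A -> Prop :=
| filtered0 : filtered 0 0
| filteredS n (s : k) a b c : filtered n a -> filtered n b -> filtered n c ->
    filtered n.+1 (s%:A + x * a + y * b + z * c).

Hypothesis tx0 : t * x = 0.
Hypothesis xz0 : x * z = 0.
Hypothesis zy0 : z * y = 0.
Hypothesis filtration : forall a, exists n, filtered n a.
Hypothesis right_syzygy : forall a b c, x * a + y * b + z * c = 0 ->
  exists f g h, [/\ a = x * f + z * g, b = x * f & c = y * h].
Hypothesis left_syzygy : forall a b c, a * x + b * y + c * z = 0 ->
  exists f g h, [/\ a = f * t, b = h * z & c = g * x].

(** In the generators [t, x, z] the relators [tx], [xz], [zy] start with different letters, so the
    conditions on the three coefficients separate. *)
Lemma right_syzygy_t a b c : t * a + x * b + z * c = 0 ->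
  exists f g h, [/\ a = x * f, b = z * g & c = y * h].
Proof.
move=> E; have [|f [g [h [e1 e2 e3]]]] := @right_syzygy (a + b) a c.
  by rewrite -E; ncring.
exists f, g, h; split=> //; apply: (addrI a); by rewrite e1 e2.
Qed.

(** The coefficient of [z] in a syzygy lies in [yA], which [z] annihilates. *)
Lemma x_z_independent a b : x * a + z * b = 0 -> x * a = 0 /\ z * b = 0.
Proof.
move=> E; have [|_ [_ [h [_ _ eb]]]] := @right_syzygy a 0 b.
  by rewrite mulr0 addr0.
have zb0 : z * b = 0 by rewrite eb mulrA zy0 mul0r.
by split=> //; rewrite zb0 addr0 in E.
Qed.

Lemma mul_y_eq0 a : y * a = 0 -> a = 0.
Proof.
move=> E; have [|f [g [_ [e1 e2 _]]]] := @right_syzygy 0 a 0.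
  by rewrite !mulr0 E !addr0.
by rewrite e2; have [] := x_z_independent (esym e1).
Qed.

Lemma mul_z_eq0 a : z * a = 0 -> exists b, a = y * b.
Proof.
move=> E; have [|_ [_ [h [_ _ ->]]]] := @right_syzygy 0 0 a; last by exists h.
by rewrite !mulr0 E !addr0.
Qed.

(** The left syzygies put [a] in [At] and in [Az]; comparing the two expressions makes the
    coefficient of [z] a left multiple of [x], and [xz = 0]. *)
Lemma eq0_mul_t a : a * t = 0 -> a = 0.
Proof.
move=> E; have [|f [_ [h [e1 e2 _]]]] := @left_syzygy a a 0.
  by rewrite mul0r addr0 -mulrDr.
have [|_ [g [_ [_ _ e3]]]] := @left_syzygy f f (- h).
  by rewrite mulNr -e2 e1; ncring.
by rewrite e2 -[h]opprK e3 mulNr -mulrA xz0 mulr0 oppr0.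
Qed.

Lemma filteredP n (s : k) a b :
  filtered n a -> filtered n b -> filtered n (s *: a + b).
Proof.
elim: n a b => [|n IH] u v.
  by inversion 1; inversion 1; rewrite scaler0 addr0; apply: filtered0.
move=> Fu Fv; inversion Fu as [|n1 s1 a1 b1 c1 Fa1 Fb1 Fc1 e1 e1']; subst.
inversion Fv as [|n2 s2 a2 b2 c2 Fa2 Fb2 Fc2 e2 e2']; subst.
rewrite [X in filtered _ X](_ : _ = (s * s1 + s2)%:A
    + x * (s *: a1 + a2) + y * (s *: b1 + b2) + z * (s *: c1 + c2)).
  by apply: filteredS; apply: IH.
by rewrite scalerDl !scalerDr scalerA !mulrDr -!scalerAr; zmod.
Qed.

Lemma filteredW n m a : (n <= m)%N -> filtered n a -> filtered m a.
Proof.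
have F0 i : filtered i 0.
  elim: i => [|i IH]; first exact: filtered0.
  have -> : (0 : A) = 0%:A + x * 0 + y * 0 + z * 0.
    by rewrite scale0r !mulr0 !addr0.
  exact: filteredS.
elim: m n a => [|m IH] [|n] a //= le_nm.
  by inversion 1; apply: F0.
by inversion 1; subst; apply: filteredS; apply: IH le_nm _.
Qed.

(** Change of generators to [t, x, z]. Only the bound on the [x]-coefficient is kept, as the
    inductions below descend through it alone. *)
Lemma filtered_t n a : filtered n.+1 a -> exists (s : k) a1 a2 a3,
  filtered n a2 /\ a = s%:A + t * a1 + x * a2 + z * a3.
Proof.
move=> F; inversion F as [|m s a1 b1 c1 Fa1 Fb1 Fc1 e1 e1']; subst.
exists s, b1, (- 1 *: b1 + a1), c1; split; first exact: filteredP.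
rewrite scaleN1r.
ncring.
Qed.

(* The scalar plus [t]-part of [a] is killed by right multiplication by [t]: the
   first component of the syzygy puts [s + a1 t] in [xA], and [t x = 0]. *)
Lemma mul_t_mem_z a b : a * t = z * b -> exists c, a = z * c.
Proof.
have [n] := filtration a; elim: n a b => [|n IH] a b.
  by inversion 1 => _; exists 0; rewrite mulr0.
move=> /filtered_t[s [a1 [a2 [a3 [F2 ->]]]]] E.
have [|f [g [h [e1 e2 e3]]]] :=
    @right_syzygy_t (s%:A + a1 * t) (a2 * t) (a3 * t - b).
  rewrite -[RHS](subrr (z * b)) -{1}E.
  ncring.
have t0 : (s%:A + t * a1) * t = 0.
  transitivity (t * (s%:A + a1 * t)); first by ncring.
  by rewrite e1 mulrA tx0 mul0r.
rewrite (eq0_mul_t t0) add0r.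
have [c ->] := IH _ _ F2 e2.
by exists a3; rewrite mulrA xz0 mul0r add0r.
Qed.

(** The syzygy kills the part [s + t a1] and leaves for [a2], which is shorter, an equation of the
    same form. *)
Lemma twisted_commutator_mem_z a b : x * a + a * t = z * b -> exists c, a = z * c.
Proof.
have [n] := filtration a; elim: n a b => [|n IH] a b.
  by inversion 1 => _; exists 0; rewrite mulr0.
move=> /filtered_t[s [a1 [a2 [a3 [F2 da]]]]] E.
have [|f [g [h [e1 e2 e3]]]] :=
    @right_syzygy_t (s%:A + a1 * t) (a + a2 * t) (a3 * t - b).
  rewrite -[RHS](subrr (z * b)) -{1}E [in a * _]da.
  ncring.
have t0 : (s%:A + t * a1) * t = 0.
  transitivity (t * (s%:A + a1 * t)); first by ncring.
  by rewrite e1 mulrA tx0 mul0r.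
rewrite (eq0_mul_t t0) add0r in da.
have [|c e] := IH a2 (g - a3) F2.
  by rewrite mulrBr -e2 da; ncring.
by exists a3; rewrite da e mulrA xz0 mul0r add0r.
Qed.

Lemma degree3_cycle a b : a * t = y * b -> z * a = 0 -> b * x = 0 ->
  exists c, a = y * c /\ b = c * t.
Proof.
move=> E /mul_z_eq0[c da] _; exists c; split=> //.
by apply/esym/subr0_eq/mul_y_eq0; rewrite mulrBr mulrA -da E subrr.
Qed.

(** [twisted_commutator_mem_z] puts [a] in [zA], so [x a = 0]; the right annihilators of [z] and [y]
    then determine [b] and [c]. *)
Lemma degree2_cycle a b c :
  x * a + a * t + z * b = 0 -> x * a + c * z = 0 -> b * x + y * c = 0 ->
  exists u v, [/\ a = - (z * u), b = u * t - y * v & c = v * x].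
Proof.
move=> E1 E2 E3; have [|a' da] := @twisted_commutator_mem_z a (- b).
  by apply/eqP; rewrite mulrN -addr_eq0 E1.
have xa0 : x * a = 0 by rewrite da mulrA xz0 mul0r.
have [|v db] := @mul_z_eq0 (b + a' * t).
  by rewrite -E1 xa0 add0r da; ncring.
have bE : b = y * v - a' * t by rewrite -db addrK.
exists (- a'), (- v); split.
- by rewrite mulrN opprK.
- by rewrite mulrN opprK mulNr addrC.
apply/eqP; rewrite mulNr -addr_eq0 addrC; apply/eqP/mul_y_eq0.
by rewrite -E3 bE mulrBl -[a' * _ * _]mulrA tx0; ncring.
Qed.

(** Commuting with [t], [x] and [y] in turn removes from the non-scalar part [a'] its components
    along [x], [t] and [z]. *)
Lemma center_scalar a : a * x = x * a -> a * y = y * a -> a * z = z * a ->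
  exists s : k, a = s%:A.
Proof.
move=> Cx Cy Cz; have [[|n]] := filtration a.
  by inversion 1; exists 0; rewrite scale0r.
move=> /filtered_t[s [a1 [a2 [a3 [_ da]]]]]; exists s.
have [a' da'] : exists a', a' = t * a1 + x * a2 + z * a3 by eexists.
have aE : a = s%:A + a' by rewrite da da' !addrA.
have comm u : a * u = u * a -> a' * u = u * a'.
  rewrite aE mulrDl mulrDr -scalerAl -scalerAr mul1r mulr1; exact: addrI.
move: (comm x Cx) (comm y Cy) (comm z Cz) => {}Cx {}Cy {}Cz.
have Ct : a' * t = t * a' by rewrite mulrDl mulrDr Cx Cy.
suff a'0 : a' = 0 by rewrite aE a'0 addr0.
have [|_ [g [_ [_ a2t _]]]] :=
    @right_syzygy_t (a1 * t - a') (a2 * t) (a3 * t).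
  by rewrite mulrBr -Ct da'; ncring.
have [c da2] := mul_t_mem_z a2t.
have xa20 : x * a2 = 0 by rewrite da2 mulrA xz0 mul0r.
rewrite xa20 addr0 in da'.
have [|_ [d [_ [_ e _]]]] := @right_syzygy_t (a1 * x) (a2 * x - a') (a3 * x).
  by rewrite mulrBr -Cx da' da2 !mulrA xz0; ncring.
have [|f [_ [_ [e1 _ _]]]] := @right_syzygy_t a1 0 (a3 + d - c * x).
  have -> : t * a1 = a' - z * a3 by rewrite da' addrK.
  by rewrite mulrBr mulrDr -e da2; ncring.
have ta10 : t * a1 = 0 by rewrite e1 mulrA tx0 mul0r.
rewrite ta10 add0r in da'.
(* Since [xz = 0], [y a'] is [t (z a3)], so that [y a' = a' y] becomes a syzygy in [t] and [z]. *)
have [|f' [_ [_ [e2 _ _]]]] := @right_syzygy_t (z * a3) 0 (- (a3 * y)).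
  have -> : t * (z * a3) = y * a' by rewrite da' !mulrA mulrDl xz0 add0r.
  by rewrite -Cy da'; ncring.
have [|_] := @x_z_independent (- f') a3; last by rewrite -da'.
by rewrite e2 mulrN addNr.
Qed.

End Syzygies.

(* Each relator is given by the list of the words whose sum it is. *)
Definition relators : seq (seq (seq letter)) :=
  [:: [:: [:: lx; lx]; [:: ly; lx]]; [:: [:: lx; lz]]; [:: [:: lz; ly]]].

(** * Syzygies of the generators from a presentation *)

Section Presentation.
Variables (k : fieldType) (F : lalgType k) (A : algType k).
Variables (G : letter -> F) (p : {linear F -> A}).

Local Notation wd w := (\prod_(i <- w) G i).
Local Notation X := (fun i => p (G i)).

(** [F] stands for the free algebra, seen through its basis of words: [word_span] is generation, in
    the form of an induction, and [word_extend] is independence. *)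
Hypothesis word_span : forall P : F -> Prop, P 0 ->
  (forall (c : k) w f, P f -> P (c *: wd w + f)) -> forall f, P f.
Hypothesis word_extend : forall (W : lmodType k) (phi : seq letter -> W),
  exists f : {linear F -> W}, forall w, f (wd w) = phi w.
Hypothesis scaleAr : forall (c : k) (f g : F), c *: (f * g) = f * (c *: g).
Hypothesis pM : forall f g, p (f * g) = p f * p g.
Hypothesis p1 : p 1 = 1.
Hypothesis p_surj : forall a, exists f, a = p f.
Hypothesis relatorP : forall rel, rel \in relators ->
  \sum_(r <- rel) p (wd r) = 0.
Hypothesis ker_span : forall P : F -> Prop, P 0 ->
  (forall (c : k) u rel v f, rel \in relators -> P f ->
     P (c *: (\sum_(r <- rel) wd (u ++ r ++ v)) + f)) ->
  forall f, p f = 0 -> P f.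

Lemma proj_word w : p (wd w) = word X w.
Proof.
elim: w => [|i w IH]; first by rewrite /word !big_nil p1.
by rewrite /word !big_cons pM IH.
Qed.

Lemma relator_word rel a b : rel \in relators ->
  \sum_(r <- rel) a * word X r * b = 0.
Proof.
move=> rel_r; have R0 := relatorP rel_r; rewrite -mulr_suml -mulr_sumr.
by under eq_bigr do rewrite -proj_word; rewrite R0 mulr0 mul0r.
Qed.

Lemma proj_relator rel u v : rel \in relators ->
  \sum_(r <- rel) p (wd (u ++ r ++ v)) = 0.
Proof.
move=> rel_r; apply: etrans (relator_word (word X u) (word X v) rel_r).
apply: eq_bigr => r _.
by rewrite !big_cat !pM !proj_word mulrA.
Qed.

Lemma presentation_relations :
  [/\ (X lx + X ly) * X lx = 0, X lx * X lz = 0 & X lz * X ly = 0].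
Proof.
have R rel := @relatorP rel; split.
- have := R _ (mem_head _ _); rewrite big_cons big_seq1 !big_cons !big_nil.
  by rewrite !mulr1 !pM mulrDl.
- have : [:: [:: lx; lz]] \in relators by rewrite !inE eqxx orbT.
  by move=> /R; rewrite big_seq1 !big_cons big_nil mulr1 pM.
have : [:: [:: lz; ly]] \in relators by rewrite !inE eqxx !orbT.
by move=> /R; rewrite big_seq1 !big_cons big_nil mulr1 pM.
Qed.

Lemma sum_letters (V : zmodType) (f : letter -> V) : \sum_i f i = f lx + f ly + f lz.
Proof.
rewrite !big_ord_recl big_ord0 addr0 addrA.
by congr (f _ + f _ + f _); apply: val_inj.
Qed.

Lemma mul_gen_word j w : G j * wd w = wd (j :: w).
Proof. by rewrite big_cons. Qed.

Lemma mul_word_gen j w : wd w * G j = wd (rcons w j).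
Proof. by rewrite -cats1 big_cat big_seq1. Qed.

Lemma sum_pair (V : zmodType) (T : Type) (f : T -> V) a b :
  \sum_(i <- [:: a; b]) f i = f a + f b.
Proof. by rewrite big_cons big_seq1. Qed.

(** Deleting a leading [i] reads off the coefficient of [G i] in the decomposition of [F] into
    scalars and the right ideals [G j F]. *)
Lemma left_derivation i : exists D : {linear F -> F},
  (forall j w, D (wd (j :: w)) = if j == i then wd w else 0) /\
  (forall j f, D (G j * f) = if j == i then f else 0).
Proof.
have [D De] := word_extend (fun w => if w is j :: w' then
  if j == i then wd w' else 0 else 0).
have Dw j w : D (wd (j :: w)) = if j == i then wd w else 0 by rewrite De.
exists D; split=> // j; apply: word_span => [|c w f IH].
  by rewrite mulr0 linear0; case: ifP.
rewrite mulrDr -scaleAr linearP mul_gen_word Dw IH.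
by case: ifP; rewrite ?scaler0 ?addr0.
Qed.

Lemma right_derivation i : exists D : {linear F -> F},
  (forall j w, D (wd (rcons w j)) = if j == i then wd w else 0) /\
  (forall j f, D (f * G j) = if j == i then f else 0).
Proof.
have [D De] := word_extend (fun w => if rev w is j :: w' then
  if j == i then wd (rev w') else 0 else 0).
have Dw j w : D (wd (rcons w j)) = if j == i then wd w else 0.
  by rewrite De rev_rcons revK.
exists D; split=> // j; apply: word_span => [|c w f IH].
  by rewrite mul0r linear0; case: ifP.
rewrite mulrDl -scalerAl linearP IH mul_word_gen Dw.
by case: ifP; rewrite ?scaler0 ?addr0.
Qed.

(** This is [I = R F + V I]: without its first letter [u r v] stays in the ideal if [u] is not
    empty; otherwise the first letters of [r] contribute a basic syzygy. *)
Lemma presentation_right_syzygy a b c : X lx * a + X ly * b + X lz * c = 0 ->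
  exists f g h, [/\ a = X lx * f + X lz * g, b = X lx * f & c = X ly * h].
Proof.
have [fa ->] := p_surj a; have [fb ->] := p_surj b; have [fc ->] := p_surj c.
rewrite -!pM -!linearD.
have [Dx [Dxw DxG]] := left_derivation lx.
have [Dy [Dyw DyG]] := left_derivation ly.
have [Dz [Dzw DzG]] := left_derivation lz.
have key e : p e = 0 -> exists f g h, [/\ p (Dx e) = X lx * f + X lz * g,
    p (Dy e) = X lx * f & p (Dz e) = X ly * h].
  move: e; apply: ker_span => [|s u rel v e rel_r [f [g [h [ex ey ez]]]]].
    by exists 0, 0, 0; rewrite !linear0 !mulr0 addr0.
  case: u => [|j u]; last first.
    have D0 (D : {linear F -> F}) i :
        (forall j w, D (wd (j :: w)) = if j == i then wd w else 0) ->
        p (D (\sum_(r <- rel) wd ((j :: u) ++ r ++ v))) = 0.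
      move=> Dw; rewrite !linear_sum; under eq_bigr do rewrite Dw.
      case: (j == i); first exact: proj_relator.
      by rewrite big1 // => r _; exact: linear0.
    exists f, g, h; rewrite !linearP /= (D0 _ _ Dxw) (D0 _ _ Dyw) (D0 _ _ Dzw).
    by rewrite scaler0 !add0r.
  have wC i w : p (wd (i :: w)) = X i * p (wd w) by rewrite big_cons pM.
  rewrite !linearP !linear_sum /= ex ey ez.
  move: rel_r; rewrite !inE => /or3P[]/eqP->; rewrite ?sum_pair ?big_seq1 /=;
    rewrite ?linearD /= ?Dxw ?Dyw ?Dzw /= ?linear0 ?wC ?addr0 ?add0r ?scaler0 ?add0r.
  (* The relators [tx], [xz], [zy], in this order, contribute to [f], [g] and [h]. *)
  - by exists (s *: p (wd v) + f), g, h; rewrite !mulrDr -!scalerAr addrA.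
  - by exists f, (s *: p (wd v) + g), h; rewrite !mulrDr -!scalerAr addrCA.
  - by exists f, g, (s *: p (wd v) + h); rewrite !mulrDr -!scalerAr.
move=> /key[f [g [h []]]]; rewrite !linearD !DxG !DyG !DzG /= !linear0 ?addr0 ?add0r.
by exists f, g, h.
Qed.

(** The mirror argument on last letters, from [I = F R + I V]. *)
Lemma presentation_left_syzygy a b c : a * X lx + b * X ly + c * X lz = 0 ->
  exists f g h, [/\ a = f * (X lx + X ly), b = h * X lz & c = g * X lx].
Proof.
have [fa ->] := p_surj a; have [fb ->] := p_surj b; have [fc ->] := p_surj c.
rewrite -!pM -!linearD.
have [Dx [Dxw DxG]] := right_derivation lx.
have [Dy [Dyw DyG]] := right_derivation ly.
have [Dz [Dzw DzG]] := right_derivation lz.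
have key e : p e = 0 -> exists f g h, [/\ p (Dx e) = f * (X lx + X ly),
    p (Dy e) = h * X lz & p (Dz e) = g * X lx].
  move: e; apply: ker_span => [|s u rel v e rel_r [f [g [h [ex ey ez]]]]].
    by exists 0, 0, 0; rewrite !linear0 !mul0r.
  case/lastP: v => [|v j]; last first.
    have D0 (D : {linear F -> F}) i :
        (forall j w, D (wd (rcons w j)) = if j == i then wd w else 0) ->
        p (D (\sum_(r <- rel) wd (u ++ r ++ rcons v j))) = 0.
      move=> Dw; rewrite !linear_sum; under eq_bigr do rewrite -!rcons_cat Dw.
      case: (j == i); first exact: proj_relator.
      by rewrite big1 // => r _; exact: linear0.
    exists f, g, h; rewrite !linearP /= (D0 _ _ Dxw) (D0 _ _ Dyw) (D0 _ _ Dzw).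
    by rewrite scaler0 !add0r.
  have wC i w : p (wd (rcons w i)) = p (wd w) * X i by rewrite -mul_word_gen pM.
  have E2 i j : u ++ [:: i; j] ++ [::] = rcons (rcons u i) j.
    by rewrite cats0 -!cats1 -catA.
  rewrite !linearP !linear_sum /= ex ey ez.
  move: rel_r; rewrite !inE => /or3P[]/eqP->; rewrite ?sum_pair ?big_seq1 !E2;
    rewrite ?linearD /= ?Dxw ?Dyw ?Dzw /= ?linear0 ?linearD /= ?wC ?addr0 ?add0r;
    rewrite ?scaler0 ?add0r.
  - exists (s *: p (wd u) + f), g, h.
    by rewrite (mulrDl (s *: _)) -scalerAl !mulrDr scalerDr; split; zmod.
  - by exists f, (s *: p (wd u) + g), h; rewrite mulrDl -!scalerAl.
  - by exists f, g, (s *: p (wd u) + h); rewrite mulrDl -!scalerAl.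
move=> /key[f [g [h []]]]; rewrite !linearD !DxG !DyG !DzG /= !linear0 ?addr0 ?add0r.
by move=> ea eb ec; exists f, g, h; split; rewrite ?ea ?linearD.
Qed.

Lemma presentation_filtered a :
  exists n, filtered (p (G lx)) (p (G ly)) (p (G lz)) n a.
Proof.
have [f ->] := p_surj a; elim/word_span: f => [|c w f [n Ff]].
  by exists 0; rewrite linear0; apply: filtered0.
suff [m Fw] : exists m, filtered (X lx) (X ly) (X lz) m (p (wd w)).
  exists (maxn m n); rewrite linearP; apply: filteredP.
    exact: filteredW (leq_maxl _ _) Fw.
  exact: filteredW (leq_maxr _ _) Ff.
have F0 m : filtered (X lx) (X ly) (X lz) m 0.
  by apply: filteredW (filtered0 _ _ _).
elim: w => [|i w [m Fw]].
  exists 1; have -> : p (wd [::]) = 1%:A + X lx * 0 + X ly * 0 + X lz * 0.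
    by rewrite big_nil p1 scale1r !mulr0 !addr0.
  exact: filteredS.
exists m.+1; pose d j := if i == j then p (wd w) else 0.
have -> : p (wd (i :: w)) = 0%:A + X lx * d lx + X ly * d ly + X lz * d lz.
  rewrite scale0r add0r -(sum_letters (fun j => X j * d j)) (bigD1 i) //=.
  rewrite [X in _ = _ + X]big1.
    by rewrite /d eqxx addr0 big_cons pM.
  by move=> j; rewrite /d eq_sym => /negPf ->; rewrite mulr0.
by apply: filteredS; rewrite /d; case: ifP.
Qed.

End Presentation.

(** * The free algebra and its basis of words *)

Section FreeAlgebra.
Variable k : fieldType.
Local Notation free_word w := (\prod_(i <- w) fgen k i).

Lemma mcoeff_word w v : (free_word w)@_(FMonom v) = (w == v)%:R.
Proof.
elim: w v => [|i w IH] v.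
  rewrite big_nil; case: v => [|j v]; first exact: mcoeff_nil1.
  apply: (etrans (mcoeff1 _ _)); congr (_%:R); apply/eqP.
  by rewrite fmP fm1.
rewrite big_cons; case: v => [|j v]; first exact: mcoeff_gen_nil.
apply: (etrans (mcoeff_gen _ _ _ _)); rewrite IH eqseq_cons.
by case: (i == j).
Qed.

Lemma malg_wordE (c : k) (m : {fmonom letter}) : << c *g m >> = c *: free_word m.
Proof.
apply/malgP=> v; rewrite -[v]fmK; apply: (etrans (mcoeffU _ _ _)).
apply: esym; apply: (etrans (mcoeffZ _ _ _)); rewrite mcoeff_word.
by rewrite mulr_natr -[m in LHS]fmK fmP.
Qed.

Lemma free_word_span (P : free_alg k -> Prop) : P 0 ->
  (forall (c : k) w f, P f -> P (c *: free_word w + f)) -> forall f, P f.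
Proof.
move=> P0 PD f; rewrite [f]monalgE; elim: (enum_fset _) => [|m s IH].
  by rewrite big_nil.
by rewrite big_cons malg_wordE; apply: PD.
Qed.

Section Extend.
Variables (W : lmodType k) (phi : seq letter -> W).

Definition free_extend (f : free_alg k) : W := \sum_(m <- msupp f) f@_m *: phi m.

(** Lets several elements be summed over one common set of words, from which linearity follows. *)
Lemma free_extendEw (d : {fset {fmonom letter}}) f : (msupp f `<=` d)%fset ->
  free_extend f = \sum_(m <- d) f@_m *: phi m.
Proof.
move=> le; rewrite [LHS](big_fset_incl _ le) => //= m md /mcoeff_outdom ->.
by rewrite scale0r.
Qed.

Fact free_extend_is_linear : linear free_extend.
Proof.
move=> c f g; pose d := (msupp f `|` msupp g)%fset.
rewrite (@free_extendEw d (c *: f + g)); last first.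
  apply: fsubset_trans (msuppD_le _ _) _; apply: fsetSU; exact: msuppZ_le.
rewrite (@free_extendEw d f) ?fsubsetUl // (@free_extendEw d g) ?fsubsetUr //.
rewrite scaler_sumr -big_split; apply: eq_bigr => m _ /=.
rewrite scalerA -scalerDl; congr (_ *: _).
by apply: (etrans (mcoeffD _ _ _)); congr (_ + _); apply: mcoeffZ.
Qed.

HB.instance Definition _ := GRing.isLinear.Build k (free_alg k) W *:%R
  free_extend free_extend_is_linear.

Lemma free_extend_word w : free_extend (free_word w) = phi w.
Proof.
rewrite (_ : free_word w = << 1 *g FMonom w >>); last first.
  by rewrite malg_wordE scale1r.
by rewrite (free_extendEw msuppU_le) big_seq_fset1 mcoeffUU scale1r.
Qed.

End Extend.

Lemma free_word_extend (W : lmodType k) (phi : seq letter -> W) :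
  exists f : {linear free_alg k -> W}, forall w, f (free_word w) = phi w.
Proof. by exists (free_extend phi) => w; exact: free_extend_word. Qed.

End FreeAlgebra.

(** * The ideal of relations as a span *)

Section FreeIdeal.
Variables (k : fieldType) (F : lalgType k) (G : letter -> F).
Local Notation wd w := (\prod_(i <- w) G i).
Hypothesis word_span : forall P : F -> Prop, P 0 ->
  (forall (c : k) w f, P f -> P (c *: wd w + f)) -> forall f, P f.
Hypothesis scaleAr : forall (c : k) (f g : F), c *: (f * g) = f * (c *: g).
Variable P : F -> Prop.
Hypothesis PD : forall (c : k) u rel v f, rel \in relators -> P f ->
  P (c *: (\sum_(r <- rel) wd (u ++ r ++ v)) + f).

(** Both [a] and [b] are expanded into words; [f] is kept general so that the terms of the expansion
    can be added one at a time. *)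
Lemma ideal_step rel a b f : rel \in relators -> P f ->
  P (a * (\sum_(r <- rel) wd r) * b + f).
Proof.
move=> rel_r; move: a b f; set r := \sum_(r <- rel) _.
apply: word_span => [b f Pf|c w a IH b f Pf]; first by rewrite !mul0r add0r.
rewrite !mulrDl -addrA; move: {IH Pf}(IH b f Pf); set g := _ + f.
move: b g; apply: word_span => [g Pg|d v b IH g Pg]; first by rewrite mulr0 add0r.
rewrite mulrDr -addrA -scaleAr -!scalerAl scalerA.
rewrite [wd w * r * wd v](_ : _ = \sum_(r <- rel) wd (w ++ r ++ v)).
  by apply: PD => //; rewrite !scalerAl; apply: IH.
rewrite /r mulr_sumr mulr_suml; apply: eq_bigr => s _.
by rewrite !big_cat /= mulrA.
Qed.

End FreeIdeal.

Section FreeIdealInstance.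
Variable k : fieldType.
Local Notation free_word w := (\prod_(i <- w) fgen k i).

Lemma relator_sum r : is_relator r ->
  exists2 rel, rel \in relators & r = \sum_(s <- rel) free_word s.
Proof.
have two i j : free_word [:: i; j] = fgen k i * fgen k j.
  by rewrite big_cons big_seq1.
case=> ->; [exists [:: [:: lx; lx]; [:: ly; lx]]|exists [:: [:: lx; lz]]|
  exists [:: [:: lz; ly]]]; rewrite ?inE ?eqxx ?orbT //.
- by rewrite sum_pair !two.
- by rewrite big_seq1 two.
- by rewrite big_seq1 two.
Qed.

Lemma relator_sumP rel : rel \in relators ->
  is_relator (\sum_(s <- rel) free_word s).
Proof.
have two i j : free_word [:: i; j] = fgen k i * fgen k j.
  by rewrite big_cons big_seq1.
rewrite !inE => /or3P[]/eqP->; rewrite ?sum_pair ?big_seq1 !two.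
- by constructor 1.
- by constructor 2.
- by constructor 3.
Qed.

Lemma alg_ker_span (P : free_alg k -> Prop) : P 0 ->
  (forall (c : k) u rel v f, rel \in relators -> P f ->
     P (c *: (\sum_(r <- rel) free_word (u ++ r ++ v)) + f)) ->
  forall f, alg_proj f = 0 -> P f.
Proof.
move=> P0 PD f; rewrite -[RHS](raddf0 (@alg_proj k)) => /alg_projP.
rewrite subr0; elim=> // a r b g /relator_sum[rel rel_r ->] _ IH.
exact: (ideal_step (@free_word_span k) (@free_scaleAr k) PD).
Qed.

Lemma alg_relatorP rel : rel \in relators ->
  \sum_(r <- rel) @alg_proj k (free_word r) = 0.
Proof.
move=> /relator_sumP rel_r; rewrite -raddf_sum -[RHS](raddf0 (@alg_proj k)).
apply/alg_projP; rewrite subr0 -[X in in_ideal X]addr0 -[X in X + 0]mulr1.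
rewrite -[X in X * 1 + 0]mul1r; apply: in_idealD rel_r _; exact: in_ideal0.
Qed.

End FreeIdealInstance.

(* The basis of V_n, each vector given by the list of the words whose sum it is. *)
Definition koszul_words n : seq (seq (seq letter)) :=
  match n with
  | 0 => [:: [:: [::]]]
  | 1 => [:: [:: [:: lx]]; [:: [:: ly]]; [:: [:: lz]]]
  | 2 => relators
  | 3 => [:: [:: [:: lx; lx; lz]; [:: ly; lx; lz]]; [:: [:: lx; lz; ly]]]
  | 4 => [:: [:: [:: lx; lx; lz; ly]; [:: ly; lx; lz; ly]]]
  | _ => [::]
  end.

Lemma koszul_basis_words (R : nzRingType) (G : letter -> R) n :
  koszul_basis_of (G lx) (G ly) (G lz) n
  = [seq \sum_(s <- rel) \prod_(i <- s) G i | rel <- koszul_words n].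
Proof.
case: n => [|[|[|[|[|n]]]]] //=; rewrite ?sum_pair ?big_seq1 ?big_nil //;
  by rewrite ?(big_cons, big_nil) ?mulr1 ?mulrDl ?mulrA.
Qed.

Lemma koszul_coefE (k : fieldType) n (j : 'I_(koszul_dim k n)) w :
  koszul_coef j w = \sum_(s <- nth [::] (koszul_words n) j) (s == w)%:R.
Proof.
have lt_j : (j < size (koszul_words n))%N.
  by rewrite -(size_map (fun rel => \sum_(s <- rel) \prod_(i <- s) fgen k i))
             -koszul_basis_words.
rewrite /koszul_coef /koszul_basis koszul_basis_words (nth_map [::]) //.
rewrite raddf_sum; apply: eq_bigr => s _; exact: mcoeff_word.
Qed.

(** Puts [lx], [ly], [lz] themselves in the goal, so that comparisons of words compute. *)
Lemma letterP (P : letter -> Prop) : P lx -> P ly -> P lz -> forall i, P i.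
Proof.
move=> Px Py Pz [[|[|[|//]]] lt_i].
- by rewrite (_ : Ordinal _ = lx) //; apply: val_inj.
- by rewrite (_ : Ordinal _ = ly) //; apply: val_inj.
- by rewrite (_ : Ordinal _ = lz) //; apply: val_inj.
Qed.

(** * The Koszul complex in coordinates *)

Section KoszulHomology.
Variables (k : fieldType) (A : algType k) (X : letter -> A).
Local Notation x := (X lx).
Local Notation y := (X ly).
Local Notation z := (X lz).
Local Notation tens n := {ffun n.-tuple letter -> A}.
Implicit Types a b c : A.

Definition tensor_of n (g : seq letter -> A) : tens n := [ffun t => g (tval t)].

(** The element [a (x) tx + b (x) xz + c (x) zy] of [A (x) V_2]. Likewise [chain3] is
    [a (x) txz + b (x) xzy] and [chain4] is [a (x) txzy]. *)
Definition chain2 a b c : tens 2 := tensor_of 2 (fun w =>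
  a *+ ([:: lx; lx] == w) + a *+ ([:: ly; lx] == w) + b *+ ([:: lx; lz] == w)
  + c *+ ([:: lz; ly] == w)).

Definition chain3 a b : tens 3 := tensor_of 3 (fun w =>
  a *+ ([:: lx; lx; lz] == w) + a *+ ([:: ly; lx; lz] == w)
  + b *+ ([:: lx; lz; ly] == w)).

Definition chain4 a : tens 4 := tensor_of 4 (fun w =>
  a *+ ([:: lx; lx; lz; ly] == w) + a *+ ([:: ly; lx; lz; ly] == w)).

Lemma koszul_d_tensor_of n g : koszul_d X (tensor_of n.+1 g) =
  tensor_of n (fun w => \sum_i (g (i :: w) * X i + (-1) ^+ n.+1 * (X i * g (rcons w i)))).
Proof. by apply/ffunP=> t; rewrite !ffunE; apply: eq_bigr => i _; rewrite !ffunE. Qed.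

Definition chain1 a b c : tens 1 := tensor_of 1 (fun w =>
  a *+ ([:: lx] == w) + b *+ ([:: ly] == w) + c *+ ([:: lz] == w)).

Let signs : ((-1) ^+ 2 = 1 :> A) * ((-1) ^+ 3 = -1 :> A) * ((-1) ^+ 4 = 1 :> A).
Proof. by do !split; rewrite -signr_odd. Qed.

Lemma d_chain4 a : koszul_d X (chain4 a) = chain3 (y * a) (a * (x + y)).
Proof.
rewrite koszul_d_tensor_of; apply/ffunP=> t; rewrite !ffunE sum_letters.
case/tupleP: t => i1 t; case/tupleP: t => i2 t; case/tupleP: t => i3 t.
rewrite (tuple0 t) {t} /=; move: i1 i2 i3.
(* The two sides are compared on each of the 27 words of length 3. *)
by apply: letterP; apply: letterP; apply: letterP => /=;
  rewrite !signs ?mulr0n ?mulr1n; ncring.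
Qed.

Lemma d_chain3 a b :
  koszul_d X (chain3 a b) = chain2 (- (z * a)) (a * (x + y) - y * b) (b * x).
Proof.
rewrite koszul_d_tensor_of; apply/ffunP=> t; rewrite !ffunE sum_letters.
case/tupleP: t => i1 t; case/tupleP: t => i2 t.
rewrite (tuple0 t) {t} /=; move: i1 i2.
by apply: letterP; apply: letterP => /=; rewrite !signs ?mulr0n ?mulr1n; ncring.
Qed.

Lemma d_chain2 a b c : koszul_d X (chain2 a b c) =
  chain1 (x * a + a * (x + y) + z * b) (x * a + c * z) (b * x + y * c).
Proof.
rewrite koszul_d_tensor_of; apply/ffunP=> t; rewrite !ffunE sum_letters.
case/tupleP: t => i1 t; rewrite (tuple0 t) {t} /=; move: i1.
by apply: letterP => /=; rewrite !signs ?mulr0n ?mulr1n; ncring.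
Qed.

Lemma chain1_eq0 a b c : chain1 a b c = 0 -> [/\ a = 0, b = 0 & c = 0].
Proof.
move=> /ffunP E; split; [have := E [tuple lx]|have := E [tuple ly]|
  have := E [tuple lz]]; by rewrite !ffunE /= ?mulr0n ?mulr1n ?addr0 ?add0r.
Qed.

Lemma chain2_eq0 a b c : chain2 a b c = 0 -> [/\ a = 0, b = 0 & c = 0].
Proof.
move=> /ffunP E; split; [have := E [tuple lx; lx]|have := E [tuple lx; lz]|
  have := E [tuple lz; ly]]; by rewrite !ffunE /= ?mulr0n ?mulr1n ?addr0 ?add0r.
Qed.

Lemma chain3_eq0 a b : chain3 a b = 0 -> a = 0 /\ b = 0.
Proof.
move=> /ffunP E; split; [have := E [tuple lx; lx; lz]|
  have := E [tuple lx; lz; ly]]; by rewrite !ffunE /= ?mulr0n ?mulr1n ?addr0 ?add0r.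
Qed.

Lemma koszul_tensorE n (a : seq A) : koszul_tensor
    [ffun j : 'I_(koszul_dim k n) => nth 0 a j] =
  tensor_of n (fun w => \sum_(j < size (koszul_words n))
    \sum_(s <- nth [::] (koszul_words n) j) nth 0 a j *+ (s == w)).
Proof.
have <- : koszul_dim k n = size (koszul_words n).
  by rewrite -(size_map (fun rel => \sum_(s <- rel) \prod_(i <- s) fgen k i))
             -koszul_basis_words.
apply/ffunP=> t; rewrite !ffunE; apply: eq_bigr => j _.
rewrite koszul_coefE scaler_suml ffunE; apply: eq_bigr => s _.
by rewrite scaler_nat.
Qed.

Lemma koszul_chainsP n (c : tens n) : koszul_chains A n c ->
  exists a : seq A, c = koszul_tensor [ffun j : 'I_(koszul_dim k n) => nth 0 a j].
Proof.
case=> a _ ->; exists [seq a j | j <- enum 'I_(koszul_dim k n)].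
congr (koszul_tensor _); apply/ffunP=> j; rewrite ffunE.
by rewrite (nth_map j) ?size_enum_ord // nth_ord_enum.
Qed.

Lemma chain2P a b c : chain2 a b c =
  koszul_tensor [ffun j : 'I_(koszul_dim k 2) => nth 0 [:: a; b; c] j].
Proof.
rewrite koszul_tensorE; apply/ffunP=> t; rewrite !ffunE /=.
by rewrite !big_ord_recl big_ord0 /= !(big_cons, big_nil) !addr0 ?addrA.
Qed.

Lemma chain3P a b : chain3 a b =
  koszul_tensor [ffun j : 'I_(koszul_dim k 3) => nth 0 [:: a; b] j].
Proof.
rewrite koszul_tensorE; apply/ffunP=> t; rewrite !ffunE /=.
by rewrite !big_ord_recl big_ord0 /= !(big_cons, big_nil) !addr0 ?addrA.
Qed.

Lemma chain4P a : chain4 a =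
  koszul_tensor [ffun j : 'I_(koszul_dim k 4) => nth 0 [:: a] j].
Proof.
rewrite koszul_tensorE; apply/ffunP=> t; rewrite !ffunE /=.
by rewrite !big_ord_recl big_ord0 /= !(big_cons, big_nil) !addr0.
Qed.

Lemma koszul_chains2P (c : tens 2) :
  koszul_chains A 2 c <-> exists a1 a2 a3, c = chain2 a1 a2 a3.
Proof.
split=> [/koszul_chainsP[a ->]|[a1 [a2 [a3 ->]]]].
  exists (nth 0 a 0), (nth 0 a 1), (nth 0 a 2); rewrite chain2P.
  by congr (koszul_tensor _); apply/ffunP=> -[[|[|[|]]] //= lt_j]; rewrite !ffunE.
by rewrite chain2P; eexists.
Qed.

Lemma koszul_chains3P (c : tens 3) :
  koszul_chains A 3 c <-> exists a1 a2, c = chain3 a1 a2.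
Proof.
split=> [/koszul_chainsP[a ->]|[a1 [a2 ->]]].
  exists (nth 0 a 0), (nth 0 a 1); rewrite chain3P.
  by congr (koszul_tensor _); apply/ffunP=> -[[|[|]] //= lt_j]; rewrite !ffunE.
by rewrite chain3P; eexists.
Qed.

Lemma koszul_chains4P (c : tens 4) : koszul_chains A 4 c <-> exists a, c = chain4 a.
Proof.
split=> [/koszul_chainsP[a ->]|[a ->]].
  exists (nth 0 a 0); rewrite chain4P.
  by congr (koszul_tensor _); apply/ffunP=> -[[|] //= lt_j]; rewrite !ffunE.
by rewrite chain4P; eexists.
Qed.

Hypothesis tx0 : (x + y) * x = 0.
Hypothesis xz0 : x * z = 0.
Hypothesis zy0 : z * y = 0.
Hypothesis filtration : forall a, exists n, filtered x y z n a.
Hypothesis right_syzygy : forall a b c, x * a + y * b + z * c = 0 ->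
  exists f g h, [/\ a = x * f + z * g, b = x * f & c = y * h].
Hypothesis left_syzygy : forall a b c, a * x + b * y + c * z = 0 ->
  exists f g h, [/\ a = f * (x + y), b = h * z & c = g * x].

Lemma boundaries1_cycles (c : tens 1) : boundaries X 1 c -> cycles X 1 c.
Proof.
case=> c2 /koszul_chains2P[a1 [a2 [a3 ->]]] ->; split; first exact: koszul_chains1.
rewrite /= d_chain2 koszul_d_tensor_of; apply/ffunP=> t; rewrite !ffunE.
rewrite sum_letters (tuple0 t) /= expr1 !mulr0n !mulr1n.
(* Every term of [d d] that survives cancellation has a relator as a factor. *)
transitivity (a1 * ((x + y) * x) + a2 * (x * z) + a3 * (z * y)
  - ((x + y) * x) * a1 - (x * z) * a2 - (z * y) * a3).
  ncring.
by rewrite tx0 xz0 zy0 !mulr0 !mul0r !subr0 !addr0.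
Qed.

(** Degrees 2 and 3 are [degree2_cycle] and [degree3_cycle], degree 4 is the injectivity of right
    multiplication by [t], and beyond it all chains are zero. *)
Lemma homology_vanishing n (c : tens n.+2) : cycles X n.+2 c -> boundaries X n.+2 c.
Proof.
case: n c => [|[|[|n]]] c [].
- move=> /koszul_chains2P[a1 [a2 [a3 ->]]] /=; rewrite d_chain2.
  case/chain1_eq0 => E1 E2 E3.
  have [u [v [-> -> ->]]] :=
    degree2_cycle tx0 xz0 zy0 filtration right_syzygy left_syzygy E1 E2 E3.
  exists (chain3 u v); last by rewrite /= d_chain3.
  by apply/koszul_chains3P; exists u, v.
- move=> /koszul_chains3P[a1 [a2 ->]] /=; rewrite d_chain3.
  case/chain2_eq0 => E1 /subr0_eq E2 E3.
  have [|c1 [-> ->]] := degree3_cycle zy0 right_syzygy E2 _ E3.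
    by rewrite -[LHS]opprK E1 oppr0.
  exists (chain4 c1); last by rewrite /= d_chain4.
  by apply/koszul_chains4P; exists c1.
- move=> /koszul_chains4P[a ->] /=; rewrite d_chain4.
  case/chain3_eq0 => _ /(eq0_mul_t xz0 left_syzygy) ->.
  rewrite (_ : chain4 0 = 0); first exact: (subspace0 (boundaries X 4)).
  by apply/ffunP=> t; rewrite !ffunE !mul0rn addr0.
move=> /koszul_chainsP[a ->] _; rewrite koszul_tensorE.
rewrite (_ : tensor_of _ _ = 0); first exact: (subspace0 (boundaries X _)).
by apply/ffunP=> t; rewrite !ffunE big_ord0.
Qed.

(** [V_0] and [V_1] fill their tensor powers, so in these degrees a null cochain vanishes on each
    word. *)
Lemma koszul_null0 (F : tens 0) : koszul_null A 0 F -> F [tuple] = 0.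
Proof.
move=> /ffunP/(_ (Ordinal (isT : 0 < koszul_dim k 0)%N)).
rewrite !ffunE (bigD1 [tuple]) //= [X in _ + X]big1 => [|t].
  by rewrite koszul_coefE /= big_seq1 eqxx scale1r addr0.
by rewrite (tuple0 t).
Qed.

Lemma koszul_null1 (F : tens 1) i : koszul_null A 1 F -> F [tuple i] = 0.
Proof.
have coefE w : koszul_coef (i : 'I_(koszul_dim k 1)) w = ([:: i] == w)%:R.
  rewrite koszul_coefE.
  by move: (i) w; apply: letterP => w /=; rewrite big_seq1.
move=> /ffunP/(_ (i : 'I_(koszul_dim k 1))).
rewrite !ffunE (bigD1 [tuple i]) //= big1 => [|t ne_ti].
  by rewrite coefE (eqxx [:: i]) scale1r addr0.
by move: ne_ti; rewrite coefE -val_eqE eq_sym /= => /negPf ->; rewrite scale0r.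
Qed.

(** The value of a 0-cocycle commutes with the three letters, hence is a scalar by [center_scalar];
    null 0-cochains vanish, so the scalar is unique. *)
Lemma HHc0_unit (phi : HHc X 0) : exists! a : k, phi = a *: hhc_one X.
Proof.
have [F ->] := proj_surj phi; have E := subspace_valP F.
have comm i : val F [tuple] * X i = X i * val F [tuple].
  have := koszul_null1 i E; rewrite !ffunE expr0 mul1r.
  have F0 t : val F t = val F [tuple] by rewrite (tuple0 t).
  rewrite !F0 theadE (ord1 ord_max) tnth0; exact: subr0_eq.
have [s Fs] := center_scalar tx0 xz0 zy0 filtration right_syzygy left_syzygy
  (comm lx) (comm ly) (comm lz).
pose u : subspace_type (cocycles X 0) := mk_elt (one_cocycle X).
have one_s (e : k) : cls _ (e *: u) = e *: hhc_one X :> HHc X 0 by exact: projZ.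
exists s; split=> [|s'].
  rewrite -one_s; apply/cls_eqP.
  rewrite (_ : _ - _ = 0); first exact: (subspace0 (koszul_null A 0)).
  by apply/ffunP=> t; rewrite !ffunE (tuple0 t) Fs subrr.
rewrite -one_s => /cls_eqP/koszul_null0; rewrite !ffunE Fs -scalerBl => /eqP.
by rewrite scaler_eq0 oner_eq0 orbF subr_eq0 => /eqP.
Qed.

End KoszulHomology.

(** * Cyclic derivatives with weights *)

Section WeightedRotations.
Variables (k : fieldType) (A : algType k) (X : letter -> A).
Local Notation tens n := {ffun n.-tuple letter -> A}.
Local Notation elem i a := (elem_tensor a [tuple i]).

(* Sum over the factorizations [s = u i v] of [(e + c |u|) v m u (x) i]. *)
Fixpoint rotations (e c : k) (m : A) (s : seq letter) : tens 1 :=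
  if s is i :: s' then
    e *: elem i (word X s' * m) + rotations (e + c) c (m * X i) s'
  else 0.

Lemma elem_tensorP n (t : n.-tuple letter) (s : k) (a b : A) :
  elem_tensor (s *: a + b) t = s *: elem_tensor a t + elem_tensor b t.
Proof. by apply/ffunP=> t'; rewrite !ffunE mulrnDl scalerMnr. Qed.

(** A letter of [u] has [v] among what follows it; a letter of [v] has [u] among what precedes it,
    which shifts its weight by [c |u|]. *)
Lemma rotations_cat e c m u v : rotations e c m (u ++ v) =
  rotations e c (word X v * m) u
  + rotations (e + c *+ size u) c (m * word X u) v.
Proof.
elim: u e m => [|i u IH] e m /=.
  by rewrite add0r mulr0n addr0 /word big_nil mulr1.
rewrite IH addrA word_cat !mulrA; congr (_ + _ + rotations _ _ _ _).
  by rewrite mulrS addrA.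
by rewrite /word big_cons mulrA.
Qed.

Lemma rotationsP s e c e' c' m u : rotations (s * e + e') (s * c + c') m u =
  s *: rotations e c m u + rotations e' c' m u.
Proof.
elim: u e e' m => [|i u IH] e e' m /=; first by rewrite scaler0 addr0.
rewrite addrACA -mulrDr IH scalerDr scalerDl !scalerA.
by rewrite addrACA.
Qed.

Lemma rotationsPm s e c m m' u : rotations e c (s *: m + m') u =
  s *: rotations e c m u + rotations e c m' u.
Proof.
elim: u e m m' => [|i u IH] e m m' /=; first by rewrite scaler0 addr0.
rewrite mulrDr -scalerAr elem_tensorP mulrDl -scalerAl IH !scalerDr !scalerA.
by rewrite addrACA [e * s]mulrC.
Qed.

Lemma rotations0m e c u : rotations e c 0 u = 0.
Proof.
by have := rotationsPm (- 1) e c 0 0 u; rewrite scaler0 addr0 scaleN1r addNr.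
Qed.

Lemma rotations_sumr (I : Type) (r : seq I) (f : I -> A) e c u :
  \sum_(i <- r) rotations e c (f i) u = rotations e c (\sum_(i <- r) f i) u.
Proof.
elim: r => [|i r IH]; first by rewrite !big_nil rotations0m.
by rewrite !big_cons IH -[f i in RHS]scale1r rotationsPm scale1r.
Qed.

Lemma rot_chainE s : rot_chain X s = rotations 1 0 1 s.
Proof.
suff H m : rotations 1 0 m s = \sum_(i < size s)
    elem_tensor (word X (drop i.+1 s) * m * word X (take i s))
      [tuple tnth (in_tuple s) i].
  by rewrite H; apply: eq_bigr => i _; rewrite mulr1.
elim: s m => [|j s IH] m /=; first by rewrite big_ord0.
rewrite addr0 IH big_ord_recl scale1r drop0 /= [word X [::]]big_nil mulr1.
congr (_ + _); apply: eq_bigr => i _.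
rewrite /= [word X (j :: _)]big_cons !mulrA; congr elem_tensor.
by rewrite !(tnth_nth lx).
Qed.

(** With constant weight the two summands of [rotations_cat] are merely exchanged. *)
Lemma rot_chainC u v : rot_chain X (u ++ v) = rot_chain X (v ++ u).
Proof. by rewrite !rot_chainE !rotations_cat !mul0rn !addr0 !mulr1 !mul1r addrC. Qed.

Lemma elem_tensor_sum (c : tens 1) : c = \sum_i elem i (c [tuple i]).
Proof.
apply/ffunP=> t; case/tupleP: t => i t; rewrite (tuple0 t) sum_ffunE.
have -> : [tuple of i :: [tuple]] = [tuple i] :> 1.-tuple letter by exact: val_inj.
rewrite (bigD1 i) //= big1 => [|j ne_ji].
  by rewrite ffunE (eqxx [tuple i]) addr0.
rewrite ffunE -val_eqE /= eqseq_cons eq_sym.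
by rewrite (negPf ne_ji).
Qed.

End WeightedRotations.

(** * Reduction of cyclic words to the words [Omega] *)

Section CyclicWords.

(** Excludes the vanishing factors [xz] and [zy], and the factor [yx] that is rewritten to [xx] up
    to sign. *)
Definition allowed : rel letter := fun i j =>
  ~~ [|| (i == lx) && (j == lz), (i == lz) && (j == ly) | (i == ly) && (j == lx)].

Lemma unsorted_factor s : ~~ sorted allowed s ->
  exists u i j v, s = u ++ i :: j :: v /\ ~~ allowed i j.
Proof.
elim: s => [|i [|j s] IH] //=; rewrite negb_and.
have [Aij /= /IH[u [i' [j' [v [-> A']]]]]|nAij _] := boolP (allowed i j).
  by exists (i :: u), i', j', v.
by exists [::], i, j, s.
Qed.

Lemma leading_block i s : path allowed i s ->
  exists n s', s = nseq n i ++ s' /\ (s' = [::] \/ exists j s'',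
    [/\ s' = j :: s'', j != i, allowed i j & path allowed j s'']).
Proof.
elim: s => [|j s IH] /=; first by exists 0, [::]; split=> //; left.
case/andP => Aij Pjs; have [eji|neji] := eqVneq j i.
  subst j; have [n [s' [-> D]]] := IH Pjs.
  by exists n.+1, s'.
by exists 0, (j :: s); split=> //; right; exists j, s.
Qed.

(** The letters can only change in the order [x], [y], [z], [x], so the word splits into blocks
    [x y^a z^b] unless some block begins with [xx]. The [z] in front makes the first block preceded
    by [z] like the others. *)
Lemma block_parse s : path allowed lz (lx :: s) -> last lx s = lz ->
  (exists u v, lz :: lx :: s = u ++ [:: lz, lx, lx & v]) \/ is_Omega (lx :: s).
Proof.
suff H n : (size s <= n)%N -> path allowed lz (lx :: s) -> last lx s = lz ->
  (exists u v, lz :: lx :: s = u ++ [:: lz, lx, lx & v]) \/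
  exists e : seq (nat * nat), [/\ e != [::],
    forall nm, nm \in e -> (0 < nm.1)%N /\ (0 < nm.2)%N
    & lx :: s = flatten [seq lx :: nseq nm.1 ly ++ nseq nm.2 lz | nm <- e]].
  move=> P L; have [|e] := H _ (leqnn _) P L; first by left.
  by right; right.
elim: n s => [|n IH] [|j s] //= le_s /andP[Axj P] L.
have [ej|njx] := eqVneq j lx.
  by left; exists [::], s; rewrite ej.
have ej : j = ly.
  by move: j Axj njx {P L}; apply: letterP.
subst j; have [a [s' [es D]]] := leading_block P.
case: D => [s'0|[j [s2 [es' nej Ayj P2]]]].
  have : last ly (nseq a ly) = ly by clear; elim: a => //= a ->.
  by move: L; rewrite es s'0 cats0 => ->.
have ej : j = lz by move: j Ayj nej {es' P2}; apply: letterP.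
subst j; have [b [s3 [es2 D]]] := leading_block P2.
case: D => [s30|[j [s4 [es3 njz Azj P4]]]].
  right; exists [:: (a.+1, b.+1)]; split=> //.
    by move=> nm; rewrite inE => /eqP->.
  by rewrite es es' es2 s30 /= !cats0.
have ej : j = lx by move: j Azj njz {es3 P4}; apply: letterP.
subst j.
have sz4 : (size s4 <= n)%N.
  by move: le_s; rewrite es es' es2 es3 !size_cat /= !size_cat /=; lia.
have L4 : last lx s4 = lz.
  by move: L; rewrite es es' es2 es3 last_cat /= last_cat.
have P4' : path allowed lz (lx :: s4) by [].
have [[u [v E]]|[e [e0 epos eE]]] := IH s4 sz4 P4' L4.
  (* The last of the [b + 1] letters [z] of the first block is the [z] in front of the remaining
     word in the recursive call. *)
  left; exists (lz :: lx :: ly :: nseq a ly ++ nseq b lz ++ u), v.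
  have shift l : lz :: nseq b lz ++ l = nseq b lz ++ lz :: l.
    by elim: (b) => //= c ->.
  by rewrite es es' es2 es3 /= -!catA -E shift.
right; exists ((a.+1, b.+1) :: e); split=> //.
  by move=> nm; rewrite inE => /orP[/eqP->|/epos].
by rewrite es es' es2 es3 eE /= -!catA.
Qed.

Section Reduction.
Variable good : seq letter -> Prop.
Hypothesis good_rot : forall u v, good (u ++ v) -> good (v ++ u).
Hypothesis good_nil : good [::].
Hypothesis good_Omega : forall s, is_Omega s -> good s.
Hypothesis good_xz : forall s, good [:: lx, lz & s].
Hypothesis good_zy : forall s, good [:: lz, ly & s].
Hypothesis good_yx : forall s, good [:: ly, lx & s] <-> good [:: lx, lx & s].

(* Rewriting [yx] to [xx] lowers the number of [y]; a word to which it does not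
   apply, even cyclically, is constant or a rotation of a product of blocks
   [x^a y^b z^c], and a block with [a > 1] gives [zxx = - zyx = 0]. *)
Lemma cyclic_reduction s : good s.
Proof.
have [n] := ubnP (count_mem ly s); elim: n s => // n IH s; rewrite ltnS => le_s.
have unsorted w : (count_mem ly w <= n)%N -> ~~ sorted allowed w -> good w.
  move=> le_w /unsorted_factor[u [i [j [v [ew nA]]]]]; subst w.
  apply: (good_rot (u := [:: i, j & v])); rewrite /=.
  have {nA} : [\/ i = lx /\ j = lz, i = lz /\ j = ly | i = ly /\ j = lx].
    by move: i j nA {le_w}; apply: letterP; apply: letterP => //= _;
      [constructor 1|constructor 3|constructor 2].
  case=> [[ei ej]|[ei ej]|[ei ej]]; rewrite ei ej //.
  apply/good_yx; apply: IH; move: le_w; rewrite ei ej !count_cat /= !count_cat /=; lia.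
(* Read cyclically, the last letter precedes the initial [x]; as it is not [x], it is [z] unless the
   word can be rewritten. *)
have start_x w : (count_mem ly (lx :: w) <= n)%N -> last lx w != lx -> good (lx :: w).
  case/lastP: w => [|w l] //; rewrite last_rcons => le_w nel.
  rewrite -rcons_cons -cats1; apply: good_rot; rewrite /=.
  have le_w' : (count_mem ly [:: l, lx & w] <= n)%N.
    by move: le_w; rewrite -cats1 /= count_cat /=; lia.
  have [So|] := boolP (sorted allowed [:: l, lx & w]); last exact: unsorted.
  have el : l = lz by move: l nel So {le_w le_w'}; apply: letterP.
  subst l; have [So'|nSo'] := boolP (sorted allowed (lx :: rcons w lz)); last first.
    apply: (good_rot (v := [:: lz]) (u := lx :: w)).
    by rewrite cats1 rcons_cons; exact: unsorted.
  have zxx v : good [:: lz, lx, lx & v].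
    apply: (good_rot (v := [:: lz]) (u := [:: lx, lx & v])); rewrite /= cats1.
    apply/good_yx; rewrite -!rcons_cons -cats1.
    apply: (good_rot (u := [:: lz]) (v := [:: ly, lx & v])); exact: good_zy.
  have [||[u [v E]]|O] := @block_parse (rcons w lz).
  - exact: So'.
  - by rewrite last_rcons.
  - apply: (good_rot (v := [:: lz]) (u := lx :: w)); rewrite cats1 rcons_cons.
    (* For empty [u] the [z] found is the one put in front, that is, the last letter of the cyclic
       word. *)
    case: u E => [|c u] /=; last first.
      by case=> _ ->; apply: (good_rot (u := [:: lz, lx, lx & v])); apply: zxx.
    case; case: w {le_w le_w' So So' nel} => //= c w [-> _].
    rewrite -2!rcons_cons -cats1.
    by apply: (good_rot (u := [:: lz]) (v := [:: lx, lx & w])); apply: zxx.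
  - apply: (good_rot (v := [:: lz]) (u := lx :: w)).
    by rewrite /= cats1; apply: good_Omega.
have last_nseq m (i : letter) : last i (nseq m i) = i by elim: m => //= m ->.
(* Rotating the leading run of [i] to the end gives a word that starts with another letter and ends
   with [i]. The case of [z] is thus reduced to [x], and that of [y] to [z]. *)
have step i w : (count_mem ly (i :: w) <= n)%N ->
    (forall j w', j != i -> allowed i j -> (count_mem ly (j :: w') <= n)%N ->
       last j w' != j -> good (j :: w')) ->
    good (i :: w) \/ exists m, w = nseq m i.
  move=> le_w next.
  have [So|/unsorted] := boolP (sorted allowed (i :: w)); last by left; auto.
  have [a [w' [ew [w'0|[j [w2 [ew' nej A _]]]]]]] := leading_block So.
    by right; exists a; rewrite ew w'0 cats0.
  left; rewrite ew ew' -cat_cons; apply: good_rot; apply: next => //.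
    by move: le_w; rewrite ew ew' /= !count_cat /=; lia.
  by rewrite last_cat /= last_nseq eq_sym.
have start_z w : (count_mem ly (lz :: w) <= n)%N -> last lz w != lz -> good (lz :: w).
  move=> le_w nez; have [|//|[m ew]] := step lz w le_w.
    move=> j w' nej A le_w' L; have ej : j = lx.
      by move: j nej A {le_w' L}; apply: letterP.
    by move: le_w' L; rewrite ej; apply: start_x.
  by rewrite ew last_nseq in nez.
have start_y w : (count_mem ly (ly :: w) <= n)%N -> last ly w != ly -> good (ly :: w).
  move=> le_w ney; have [|//|[m ew]] := step ly w le_w.
    move=> j w' nej A le_w' L; have ej : j = lz.
      by move: j nej A {le_w' L}; apply: letterP.
    by move: le_w' L; rewrite ej; apply: start_z.
  by rewrite ew last_nseq in ney.
case: s le_s => // i w le_w; have [|//|[m ->]] := step i w le_w.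
  move=> j w' _ _; move: j.
  by apply: letterP; [exact: start_x|exact: start_y|exact: start_z].
apply: good_Omega; left; exists m.+1 => //; move: i {le_w}.
by apply: letterP; [constructor 1|constructor 2|constructor 3].
Qed.

End Reduction.
End CyclicWords.

(** * Bilinearity and values of the cap product *)

Section CapProduct.
Variables (k : fieldType) (A : algType k) (X : letter -> A).
Local Notation tens n := {ffun n.-tuple letter -> A}.
Local Notation elem i a := (elem_tensor a [tuple i]).

Lemma hh_classP n (a : k) (c d : Defs.cycle X n) :
  hh_class (a *: c + d) = a *: hh_class c + hh_class d.
Proof. exact: proj_is_linear. Qed.

Lemma hhc_classP n (a : k) (f g : cocycle X n) :
  hhc_class (a *: f + g) = a *: hhc_class f + hhc_class g.
Proof. exact: proj_is_linear. Qed.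

Lemma hh_class_surj n (xi : HH X n) : exists c : Defs.cycle X n, xi = hh_class c.
Proof. exact: proj_surj. Qed.

Lemma hhc_class_surj n (phi : HHc X n) : exists f : cocycle X n, phi = hhc_class f.
Proof. exact: proj_surj. Qed.

Lemma capPl m p (a : k) (xi eta : HH X (m + p)) (phi : HHc X m) :
  cap (a *: xi + eta) phi = a *: cap xi phi + cap eta phi.
Proof.
have [c ->] := hh_class_surj xi; have [d ->] := hh_class_surj eta.
have [f ->] := hhc_class_surj phi; rewrite -hh_classP !capE -hh_classP.
by congr (hh_class _); apply: val_inj; apply: chain_cap_is_linearl.
Qed.

Lemma capPr m p (a : k) (xi : HH X (m + p)) (phi psi : HHc X m) :
  cap xi (a *: phi + psi) = a *: cap xi phi + cap xi psi.
Proof.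
have [c ->] := hh_class_surj xi; have [f ->] := hhc_class_surj phi.
have [g ->] := hhc_class_surj psi; rewrite -hhc_classP !capE -hh_classP.
by congr (hh_class _); apply: val_inj; apply: chain_cap_is_linearr.
Qed.

Lemma sum_tuple0 (V : zmodType) (f : 0.-tuple letter -> V) : \sum_t f t = f [tuple].
Proof.
rewrite (bigD1 [tuple]) //= big1 ?addr0 // => t.
by rewrite (tuple0 t) (eqxx [tuple]).
Qed.

Lemma cap1 p (xi : HH X p) : cap (m := 0) xi (hhc_one X) = xi.
Proof.
have [c ->] := hh_class_surj xi; rewrite capE; congr (hh_class _).
apply: val_inj; apply/ffunP=> t; rewrite /= ffunE mul0n expr0 mul1r sum_tuple0.
by rewrite ffunE mulr1; apply: at_word_val.
Qed.

Lemma d_elem_tensor (a : A) i : koszul_d X (elem i a) = [ffun => a * X i - X i * a].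
Proof.
have E t : (elem i a) t = a *+ (tval t == [:: i]) by rewrite ffunE -val_eqE.
apply/ffunP=> t; rewrite !ffunE (tuple0 t).
under eq_bigr => j _ do rewrite !E /= eqseq_cons andbT.
rewrite (bigD1 i) //= big1 => [|j /negPf ne_ji].
  by rewrite (eqxx i) !mulr1n expr1 mulN1r addr0.
by rewrite ne_ji !mulr0n mul0r !mulr0 addr0.
Qed.

(** The word is moved across [a] letter by letter; moving the letter [i] of [i w] costs the boundary
    of [w a (x) i]. *)
Lemma commutator_boundary (a : A) w :
  boundaries X 0 [ffun => a * word X w - word X w * a].
Proof.
elim: w a => [|i w IH] a.
  rewrite (_ : [ffun _ => _] = 0); first exact: (subspace0 (boundaries X 0)).
  by apply/ffunP=> t; rewrite !ffunE /word big_nil mulr1 mul1r subrr.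
rewrite (_ : [ffun _ => _] = [ffun => a * X i * word X w - word X w * (a * X i)]
    + koszul_d X (elem i (word X w * a))); last first.
  apply/ffunP=> t; rewrite d_elem_tensor !ffunE /word big_cons.
  ncring.
apply: (subD (S := boundaries X 0)); first exact: IH.
by exists (elem i (word X w * a)) => //; apply: koszul_chains1.
Qed.

(** The cap product is the sum of the [- w u f(v)], and each term differs from [- u f(v) w] by a
    commutator with the word [w]. *)
Lemma cap_rot_cycle Omega (f : cocycle X 1) :
  cap (m := 1) (p := 0) (hh_class (Defs.rot_cycle X Omega)) (hhc_class f)
  = - hh0_class X (\sum_(i < size Omega)
        word X (take i Omega) * subspace_val f [tuple tnth (in_tuple Omega) i]
        * word X (drop i.+1 Omega)).
Proof.
rewrite capE.
have hhN (c : Defs.cycle X 0) : - hh_class c = hh_class (- c).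
  exact/esym/(raddfN (proj _)).
rewrite hhN; apply/cls_eqP.
set f' := subspace_val f.
pose u i := word X (take i Omega).
pose v (i : 'I_(size Omega)) := tnth (in_tuple Omega) i.
pose w i := word X (drop i.+1 Omega).
suff -> : val (cycle_cap (m := 1) (p := 0) (Defs.rot_cycle X Omega) f)
      - val (- mk_elt (const_cycle X (\sum_(i < size Omega) u i * f' [tuple v i] * w i)))
    = \sum_(i < size Omega)
        [ffun => u i * f' [tuple v i] * w i - w i * (u i * f' [tuple v i])].
  by apply: sub_sum => i; apply: commutator_boundary.
apply/ffunP=> t; rewrite /= !ffunE opprK sum_ffunE.
under [in RHS]eq_bigr do rewrite ffunE.
rewrite sumrB addrC; congr (_ + _); rewrite expr1 mulN1r; congr (- _).
have atE s : at_word (rot_chain X Omega) (tval s ++ t) = rot_chain X Omega s.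
  by apply: at_word_val; rewrite (tuple0 t) cats0.
under eq_bigr do rewrite atE /rot_chain sum_ffunE mulr_suml.
rewrite exchange_big; apply: eq_bigr => i _ /=.
rewrite (bigD1 [tuple v i]) //= big1 => [|s /negPf nes]; last first.
  by rewrite ffunE nes mul0r.
by rewrite ffunE (eqxx [tuple v i]) addr0 mulrA.
Qed.

End CapProduct.

(** * Generators of the homology in degree one *)

Section DegreeOneHomology.
Variables (k : fieldType) (F : lalgType k) (A : algType k).
Variables (G : letter -> F) (p : {linear F -> A}).
Hypothesis char0 : forall n, n.+1%:R != 0 :> k.

Local Notation wd w := (\prod_(i <- w) G i).
Local Notation X := (fun i => p (G i)).
Local Notation x := (p (G lx)).
Local Notation y := (p (G ly)).
Local Notation z := (p (G lz)).
Local Notation tens n := {ffun n.-tuple letter -> A}.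
Local Notation elem i a := (elem_tensor a [tuple i]).

Hypothesis word_span : forall P : F -> Prop, P 0 ->
  (forall (c : k) w f, P f -> P (c *: wd w + f)) -> forall f, P f.
Hypothesis word_extend : forall (W : lmodType k) (phi : seq letter -> W),
  exists f : {linear F -> W}, forall w, f (wd w) = phi w.
Hypothesis scaleAr : forall (c : k) (f g : F), c *: (f * g) = f * (c *: g).
Hypothesis pM : forall f g, p (f * g) = p f * p g.
Hypothesis p1 : p 1 = 1.
Hypothesis p_surj : forall a, exists f, a = p f.
Hypothesis relatorP : forall rel, rel \in relators ->
  \sum_(r <- rel) p (wd r) = 0.
Hypothesis ker_span : forall P : F -> Prop, P 0 ->
  (forall (c : k) u rel v f, rel \in relators -> P f ->
     P (c *: (\sum_(r <- rel) wd (u ++ r ++ v)) + f)) ->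
  forall f, p f = 0 -> P f.

Lemma chain1_linear s a b c a' b' c' :
  chain1 (s *: a + a') (s *: b + b') (s *: c + c') =
  s *: chain1 a b c + chain1 a' b' c' :> tens 1.
Proof.
apply/ffunP=> t; rewrite !ffunE !mulrnDl !scalerMnr !scalerDr -!scalerMnr.
by rewrite !scalerMnr; zmod.
Qed.

Lemma chain2_linear s a b c a' b' c' :
  chain2 (s *: a + a') (s *: b + b') (s *: c + c') =
  s *: chain2 a b c + chain2 a' b' c' :> tens 2.
Proof. by apply/ffunP=> t; rewrite !ffunE !mulrnDl !scalerDr !scalerMnr; zmod. Qed.

(** The half [m v1 (x) v2] of the differential of [m (x) v1 v2], taken on [chain2 a b c]. *)
Local Notation tau a b c := (chain1 (a * (x + y)) (c * z) (b * x)).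

(** The two rotations of a word of length 2 are the two terms of [d]; the weights 0 and 1 select the
    one that enters [tau]. *)
Lemma relator_rotations rel m : rel \in relators -> exists a b c,
  \sum_(r <- rel) rotations X 1 0 m r = koszul_d X (chain2 a b c) /\
  \sum_(r <- rel) rotations X 0 1 m r = tau a b c.
Proof.
have one i : word X [:: i] = X i by exact: big_seq1.
have nil : word X [::] = 1 by exact: big_nil.
rewrite !inE => /or3P[]/eqP->; [exists m, 0, 0|exists 0, m, 0|exists 0, 0, m];
  rewrite d_chain2 ?sum_pair ?big_seq1 /= !one nil.
all: split; apply/ffunP=> t; case/tupleP: t => i t; rewrite (tuple0 t) {t}.
all: move: i; apply: letterP; rewrite !ffunE -!val_eqE /=.
all: by rewrite ?mulr0n ?mulr1n ?addr0 ?add0r ?scale0r ?scale1r ?scaler0; ncring.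
Qed.

(** Rotations at a letter of [w] have the whole relator in their coefficient and sum to zero; those
    at a letter of [r] form a boundary. *)
Lemma rot_chain_relator rel w : rel \in relators ->
  boundaries X 1 (\sum_(r <- rel) rot_chain X (r ++ w)).
Proof.
move=> rel_r; have [a [b [c [E _]]]] := relator_rotations (word X w * 1) rel_r.
exists (chain2 a b c); first by apply/koszul_chains2P; do 3! eexists.
rewrite /= -E; under eq_bigr do rewrite rot_chainE rotations_cat.
rewrite big_split /= [X in _ + X](_ : _ = 0) ?addr0 //.
rewrite -[RHS](rotations0m X 1 0 w) -(relator_word pM p1 relatorP 1 1 rel_r).
rewrite -rotations_sumr big_seq [RHS]big_seq; apply: eq_bigr => r _.
by rewrite mul0rn addr0 mulr1.
Qed.

(** Let [d'] be the half of [d] that moves the first letter. From [d' d' = 0] and [d d = 0] follows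
    [d' d = - d d']; the cycle is [d] of a 3-chain by exactness, and the witness is minus [d'] of
    this 3-chain. *)
Lemma tau_boundary a b c : koszul_d X (chain2 a b c) = 0 ->
  boundaries X 1 (tau a b c).
Proof.
have [tx0 xz0 zy0] := presentation_relations pM relatorP.
rewrite d_chain2 => /chain1_eq0[E1 E2 E3].
have [u [v [-> -> ->]]] := degree2_cycle tx0 xz0 zy0
  (presentation_filtered word_span pM p1 p_surj)
  (presentation_right_syzygy word_span word_extend scaleAr pM p1 p_surj
     relatorP ker_span)
  (presentation_left_syzygy word_span word_extend pM p1 p_surj
     relatorP ker_span) E1 E2 E3.
exists (chain2 0 (- (u * (x + y))) (- (v * x))).
  by apply/koszul_chains2P; do 3! eexists.
rewrite /= d_chain2; congr chain1; rewrite ?mulr0 ?mul0r ?add0r.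
- by ncring.
- by rewrite mulNr -!mulrA xz0 !mulr0 oppr0.
by rewrite mulrBl mulNr -[u * _ * x]mulrA tx0 mulr0 oppr0 mulrN !mulrA.
Qed.

(** For the empty word the inverse length is 0 by convention, which is harmless as there is nothing
    to rotate. *)
Lemma weighted_rotations : exists R Ps : {linear F -> tens 1},
  (forall w, R (wd w) = (size w)%:R^-1 *: rotations X 1 0 1 w) /\
  (forall w, Ps (wd w) = (size w)%:R^-1 *: rotations X 0 1 1 w).
Proof.
have [R RE] := word_extend (fun w => (size w)%:R^-1 *: rotations X 1 0 1 w).
have [Ps PsE] := word_extend (fun w => (size w)%:R^-1 *: rotations X 0 1 1 w).
by exists R, Ps.
Qed.

Section Homotopy.
Variables R Ps : {linear F -> tens 1}.
Hypothesis RE : forall w, R (wd w) = (size w)%:R^-1 *: rotations X 1 0 1 w.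
Hypothesis PsE : forall w, Ps (wd w) = (size w)%:R^-1 *: rotations X 0 1 1 w.

(* Moving the last letter [i] of a word to the front raises the weight of every
   other letter by one and lowers that of [i] by the length minus one. *)
Lemma homotopy_commutator f i :
  Ps (f * G i - G i * f) = elem i (p f) - R (f * G i) /\
  R (f * G i - G i * f) = 0.
Proof.
elim/word_span: f => [|c w f [IHP IHR]].
  rewrite !mul0r !mulr0 subrr !linear0 addr0; split=> //.
  by apply/ffunP=> t; rewrite !ffunE mul0rn.
rewrite mulrDl mulrDr -scalerAl -scaleAr opprD addrACA -scalerBr !linearP IHP IHR.
rewrite elem_tensorP addrACA -scalerDr /=.
suff [-> ->] : Ps (wd w * G i - G i * wd w) = elem i (p (wd w)) - R (wd w * G i) /\
    R (wd w * G i - G i * wd w) = 0 by rewrite scaler0 addr0.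
rewrite mul_gen_word mul_word_gen !linearB !RE !PsE size_rcons /=.
have nil : word X [::] = 1 by exact: big_nil.
have one j : word X [:: j] = X j by exact: big_seq1.
rewrite -cats1 !rotations_cat /= !(nil, one, proj_word G pM p1).
rewrite !(addr0, add0r, mul1r, mulr1, mul0rn, scale0r, scale1r).
have := rotationsP X 1 1 0 0 1 (X i) w.
rewrite mulr1 mulr0 addr0 add0r scale1r => ->.
set E := elem i _; set n1 := _^-1.
(* Characteristic 0 makes the length [|w| + 1] invertible. *)
have EE : E = n1 *: ((size w)%:R *: E + E).
  by rewrite -[X in _ + X]scale1r -scalerDl natr1 scalerA mulVf ?scale1r.
split; last by rewrite [E + _]addrC subrr.
rewrite {2}EE -!scalerBr; congr (_ *: _); zmod.
Qed.

(** In [u r v] only the letters of [r] count, the other coefficients containing the relator. They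
    give [d E] with constant weight and [|u| d E + tau E] with the weight of the position, and the
    words of the sum share one length [N]. *)
Lemma homotopy_kernel f : p f = 0 -> exists a b c,
  R f = koszul_d X (chain2 a b c) /\ boundaries X 1 (Ps f - tau a b c).
Proof.
move: f; apply: ker_span => [|s u rel v f rel_r [a [b [c [Rf Pf]]]]].
  exists 0, 0, 0; have c20 : chain2 0 0 0 = 0 :> tens 2.
    by apply/ffunP=> t; rewrite !ffunE !mul0rn !addr0.
  rewrite c20 !mul0r !linear0; split=> //.
  rewrite (_ : 0 - _ = 0); first exact: (subspace0 (boundaries X 1)).
  by apply/ffunP=> t; rewrite !ffunE !mul0rn !addr0 subr0.
pose m := word X v * word X u; pose N := (size u + (2 + size v))%N.
have szr r : r \in rel -> size r = 2.
  by move: rel_r r; rewrite !inE => /or3P[]/eqP-> r; rewrite !inE;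
     do ?[case/orP]; move/eqP->.
have middle e c0 : \sum_(r <- rel) rotations X e c0 1 (u ++ r ++ v) =
    \sum_(r <- rel) rotations X (e + c0 *+ size u) c0 m r.
  transitivity (\sum_(r <- rel) (rotations X e c0 (1 * word X r * word X v) u
      + rotations X (e + c0 *+ size u) c0 m r
      + rotations X (e + c0 *+ size u + c0 *+ 2) c0 (word X u * word X r * 1) v)).
    rewrite big_seq [RHS]big_seq; apply: eq_bigr => r /szr szr2.
    rewrite !rotations_cat word_cat szr2.
    by rewrite /m !mul1r !mulr1 addrA.
  rewrite !big_split /= !rotations_sumr !(relator_word pM p1 relatorP) //.
  by rewrite !rotations0m addr0 add0r.
have [a' [b' [c' [R' P']]]] := relator_rotations m rel_r.
have szN r : r \in rel -> size (u ++ r ++ v) = N.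
  by move=> /szr sz; rewrite !size_cat sz.
pose s' := s * N%:R^-1.
have RW : s *: R (\sum_(r <- rel) wd (u ++ r ++ v)) =
    s' *: koszul_d X (chain2 a' b' c').
  rewrite linear_sum -R' /s' -scalerA; congr (_ *: _).
  transitivity (\sum_(r <- rel) N%:R^-1 *: rotations X 1 0 1 (u ++ r ++ v)).
    by rewrite big_seq [RHS]big_seq; apply: eq_bigr => r /szN sz; rewrite RE sz.
  by rewrite -scaler_sumr middle mul0rn addr0.
have PW : s *: Ps (\sum_(r <- rel) wd (u ++ r ++ v)) =
    s' *: ((size u)%:R *: koszul_d X (chain2 a' b' c') + tau a' b' c').
  rewrite linear_sum -R' -P' /s' -scalerA; congr (_ *: _).
  transitivity (\sum_(r <- rel) N%:R^-1 *: rotations X 0 1 1 (u ++ r ++ v)).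
    by rewrite big_seq [RHS]big_seq; apply: eq_bigr => r /szN sz; rewrite PsE sz.
  rewrite -scaler_sumr middle; congr (_ *: _).
  rewrite scaler_sumr -big_split; apply: eq_bigr => r _ /=.
  by rewrite -rotationsP mulr1 mulr0 addr0 !add0r.
exists (s' *: a' + a), (s' *: b' + b), (s' *: c' + c).
rewrite chain2_linear !linearP /= Rf RW; split=> //.
have -> : tau (s' *: a' + a) (s' *: b' + b) (s' *: c' + c) =
    s' *: tau a' b' c' + tau a b c.
  by rewrite -chain1_linear !mulrDl -!scalerAl.
rewrite PW; set d := koszul_d _ _; set t' := chain1 _ _ _; set t := chain1 _ _ _.
have -> : s' *: ((size u)%:R *: d + t') + Ps f - (s' *: t' + t) =
    (s' * (size u)%:R) *: d + (Ps f - t) by rewrite scalerDr scalerA; zmod.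
apply: (subspaceP (s := boundaries X 1)); last exact: Pf.
by exists (chain2 a' b' c') => //; apply/koszul_chains2P; do 3! eexists.
Qed.

End Homotopy.

Lemma HH1_span (S : subspace (tens 1)) :
  (forall c, boundaries X 1 c -> S c) -> (forall w, S (rot_chain X w)) ->
  forall c, cycles X 1 c -> S c.
Proof.
move=> Sbd Srot c [_ dc0].
have [R [Ps [RE PsE]]] := weighted_rotations.
have SR f : S (R f).
  elim/word_span: f => [|s w f Sf]; first by rewrite linear0; exact: subspace0.
  by rewrite linearP; apply: subspaceP => //; rewrite RE -rot_chainE; apply: subZ.
have [f fE] : exists f : letter -> F, forall i, p (f i) = c [tuple i].
  have [fx ex] := p_surj (c [tuple lx]); have [fy ey] := p_surj (c [tuple ly]).
  have [fz ez] := p_surj (c [tuple lz]).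
  exists (fun i => if i == lx then fx else if i == ly then fy else fz).
  by apply: letterP.
(* Since [f] lifts the coefficients of [c], the element [g] lifts [d c], which is 0. *)
pose g := \sum_i (f i * G i - G i * f i).
have pg0 : p g = 0.
  have := congr1 (fun h : tens 0 => h [tuple]) (dc0 : koszul_d X c = 0).
  rewrite !ffunE linear_sum => d0; rewrite -[RHS]d0; apply: eq_bigr => i _.
  rewrite linearB !pM !fE expr1 mulN1r.
  by congr (c _ * _ - _ * c _); apply: val_inj.
have [a [b [c' [Rg Pg]]]] := homotopy_kernel RE PsE pg0.
have Rg0 : R g = 0.
  rewrite linear_sum big1 // => i _.
  by have [] := homotopy_commutator RE PsE (f i) i.
(* Summing [homotopy_commutator] over the letters splits [c] into a term [Ps g], with [g] in the
   kernel, and a combination of cyclic derivatives. *)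
have cE : c = Ps g + R (\sum_i f i * G i).
  rewrite !linear_sum -big_split {1}[c]elem_tensor_sum; apply: eq_bigr => i _.
  by have [-> _] := homotopy_commutator RE PsE (f i) i; rewrite fE /= subrK.
rewrite cE; apply: subD => //; apply: Sbd.
rewrite -[Ps g](subrK (tau a b c')); apply: (subD (S := boundaries X 1)) => //.
by apply: tau_boundary; rewrite -Rg.
Qed.

(** Membership of [rot_chain] in [S] satisfies the rules of [cyclic_reduction]: it is cyclic by
    [rot_chainC], and the relators hold modulo boundaries. *)
Lemma HH1_Omega_span (S : subspace (tens 1)) :
  (forall c, boundaries X 1 c -> S c) ->
  (forall Omega, is_Omega Omega -> S (rot_chain X Omega)) ->
  forall c, cycles X 1 c -> S c.
Proof.
move=> Sbd SOm; apply: HH1_span (Sbd) _ => w.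
have R1 r s : [:: r] \in relators -> S (rot_chain X (r ++ s)).
  by move=> /(rot_chain_relator s)/Sbd; rewrite big_seq1.
apply: (cyclic_reduction (good := fun s => S (rot_chain X s))) => [u v||//|s|s|s].
- by rewrite rot_chainC.
- rewrite /rot_chain big_ord0; exact: subspace0.
- by apply: (R1 [:: lx; lz]); rewrite !inE eqxx orbT.
- by apply: (R1 [:: lz; ly]); rewrite !inE eqxx !orbT.
have /Sbd := rot_chain_relator s (mem_head _ _); rewrite sum_pair /= => Ss.
split=> Sr; [rewrite -[rot_chain _ _](addrK (rot_chain X [:: ly, lx & s]))|
  rewrite -[rot_chain _ _](addrK (rot_chain X [:: lx, lx & s])) [X in X - _]addrC];
  by apply: subD => //; apply: subN.
Qed.

Lemma HH1_ind (P : HH X 1 -> Prop) : P 0 ->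
  (forall (a : k) xi eta, P xi -> P eta -> P (a *: xi + eta)) ->
  (forall Omega, is_Omega Omega -> P (hh_class (Defs.rot_cycle X Omega))) ->
  forall xi, P xi.
Proof.
move=> P0 PD POm xi; have [c ->] := hh_class_surj xi.
(* [T] transports [P] from classes to a subspace of chains, so that the spanning result applies. *)
pose T (b : tens 1) := exists2 d : Defs.cycle X 1, val d = b & P (hh_class d).
have T0 : T 0 by exists 0 => //; rewrite [hh_class 0](raddf0 (proj _)).
have TD (a : k) u v : T u -> T v -> T (a *: u + v).
  move=> [d <- Pd] [e <- Pe]; exists (a *: d + e) => //.
  by rewrite hh_classP; apply: PD.
have [b bd_b|Omega Om||d /val_inj <-] // :=
  @HH1_Omega_span (Subspace T0 TD) _ _ (val c).
- have [tx0 xz0 zy0] := presentation_relations pM relatorP.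
  exists (mk_elt (boundaries1_cycles tx0 xz0 zy0 bd_b)) => //.
  rewrite (_ : hh_class _ = 0) // -[RHS](raddf0 (proj _)).
  by apply/cls_eqP; rewrite /= subr0.
- by exists (Defs.rot_cycle X Omega) => //; apply: POm.
exact: subspace_valP.
Qed.

End DegreeOneHomology.

(** * The algebra [A] and the uniqueness of the action *)

Section Assembly.
Variable k : fieldType.
Hypothesis char_k : [pchar k] =i pred0.
Local Notation X := (@agen k).

Let char0 n : n.+1%:R != 0 :> k.
Proof. by have /pcharf0P-> := char_k. Qed.

Let pM : {morph @alg_proj k : f g / f * g}. Proof. exact: rmorphM. Qed.
Let p1 : @alg_proj k 1 = 1. Proof. exact: rmorph1. Qed.

Let span := @free_word_span k.
Let extend := @free_word_extend k.
Let kerspan := @alg_ker_span k.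
Let filtration := presentation_filtered span pM p1 (@alg_proj_surj k).
Let right_syzygy := presentation_right_syzygy span extend (@free_scaleAr k) pM p1
  (@alg_proj_surj k) (@alg_relatorP k) kerspan.
Let left_syzygy := presentation_left_syzygy span extend pM p1
  (@alg_proj_surj k) (@alg_relatorP k) kerspan.

Let relations := presentation_relations pM (@alg_relatorP k).

Lemma HHc0_alg (phi : HHc X 0) : exists! a : k, phi = a *: hhc_one X.
Proof.
case: relations => tx0 xz0 zy0.
exact: HHc0_unit tx0 xz0 zy0 filtration right_syzygy left_syzygy phi.
Qed.

Lemma HH_alg_eq0 n (xi : HH X n.+2) : xi = 0.
Proof.
have [c ->] := hh_class_surj xi; case: relations => tx0 xz0 zy0.
rewrite -[RHS](raddf0 (proj _)); apply/cls_eqP; rewrite /= subr0.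
apply: homology_vanishing tx0 xz0 zy0 filtration right_syzygy left_syzygy _ _ _.
exact: subspace_valP.
Qed.

Lemma HH1_alg_ind (P : HH X 1 -> Prop) : P 0 ->
  (forall (a : k) xi eta, P xi -> P eta -> P (a *: xi + eta)) ->
  (forall Omega, is_Omega Omega -> P (hh_class (Defs.rot_cycle X Omega))) ->
  forall xi, P xi.
Proof.
exact: (HH1_ind char0 span extend (@free_scaleAr k) pM p1
  (@alg_proj_surj k) (@alg_relatorP k) kerspan).
Qed.

End Assembly.

Theorem proposition4p2 (k : fieldType) (char_k : [pchar k] =i pred0) :
  (* HH^0 (A) = k, spanned by its unit *)
  (forall phi : HHc (@agen k) 0, exists! a : k, phi = a *: hhc_one (@agen k)) /\
  (* the equations satisfied by the cap product *)
  bilinear_pairing (@cap k (alg k) (@agen k)) /\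
  unit_equation (@cap k (alg k) (@agen k)) /\
  Omega_equations (@cap k (alg k) (@agen k)) /\
  (* they determine it *)
  (forall act : graded_pairing k,
    bilinear_pairing act -> unit_equation act -> Omega_equations act ->
    forall (m p : nat) (xi : HH (@agen k) (m + p)) (phi : HHc (@agen k) m),
      act m p xi phi = cap xi phi).
Proof.
split; first exact: HHc0_alg.
have cap_bil : bilinear_pairing (@cap k (alg k) (@agen k)).
  by split=> *; [apply: capPl|apply: capPr].
have cap_unit : unit_equation (@cap k (alg k) (@agen k)).
  by move=> p xi; apply: cap1.
have cap_Omega : Omega_equations (@cap k (alg k) (@agen k)).
  by move=> Omega f _; apply: cap_rot_cycle.
do 3! split=> //; move=> act act_bil act_unit act_Omega.
have bil0l (b : graded_pairing k) m p phi : bilinear_pairing b -> b m p 0 phi = 0.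
  move=> b_bil; have [L _] := b_bil m p.
  by have := L (- 1) 0 0 phi; rewrite scaler0 addr0 scaleN1r addNr.
have bil0r (b : graded_pairing k) m p xi : bilinear_pairing b -> b m p xi 0 = 0.
  move=> b_bil; have [_ L] := b_bil m p.
  by have := L (- 1) xi 0 0; rewrite scaler0 addr0 scaleN1r addNr.
case=> [|[|m]] p xi phi.
- have [a [-> _]] := HHc0_alg phi; rewrite -[a *: _]addr0.
  have [_ L] := act_bil 0 p; have [_ L'] := cap_bil 0 p; rewrite L L'.
  by rewrite act_unit (cap_unit p) !bil0r.
- case: p xi => [|p] xi; last by rewrite (HH_alg_eq0 xi) !bil0l.
  apply: (HH1_alg_ind char_k (P := fun xi : HH (@agen k) 1 =>
    act 1 0 xi phi = cap (m := 1) (p := 0) xi phi) _ _ _ xi).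
  + by rewrite !bil0l.
  + move=> a u v; have [L _] := act_bil 1 0; have [L' _] := cap_bil 1 0.
    by rewrite L L' => -> ->.
  + by move=> Omega Om; have [f ->] := hhc_class_surj phi; rewrite act_Omega ?cap_Omega.
by rewrite (HH_alg_eq0 xi) !bil0l.
Qed.
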